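(* Let initial data $\mathcal F_i^{(abs)},\mathcal F_i^{(scat)}$ satisfy conditions (i), (ii), (iii) below, and let $f$ be the corresponding solution of the Liouville equation on $\Gamma_{accr}$. Let $\gamma(t)=(t,r_*,\vartheta_*,\varphi_* )$, $r_*>2M_H$, be the world line of a static observer. Then for all $\alpha,\beta\in\{0,1,2,3\}$, $$\lim_{t\to\infty}J_\alpha(\gamma(t))=J_\alpha[f_{-\infty}],\qquad \lim_{t\to\infty}T_{\alpha\beta}(\gamma(t))=T_{\alpha\beta}[f_{-\infty}],$$ where $J_\alpha,T_{\alpha\beta}$ are the components of the current density and stress energy-momentum tensor of $f$ with respect to the frame $\{e_0,e_1,e_2,e_3\}$, and $J_\alpha[f_{-\infty}],T_{\alpha\beta}[f_{-\infty}]$ are the corresponding (time-independent) components at $(r_*,\vartheta_*,\varphi_* )$ of the observables of the stationary spherically symmetric distribution $f_{st}(x,p)=\delta(P_0(x,p)-m)f_{-\infty}(P_1(x,p)/m)$ on $\Gamma_{accr}$.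
   Context: Fix $M_H>0$ and particle mass $m>0$. Spacetime: coordinates $(t,r,\vartheta,\varphi)$, $r>0$, inverse metric $g^{-1}=-(1+\tfrac{2M_H}{r})\partial_t\otimes\partial_t+\tfrac{4M_H}{r}\partial_t\otimes_s\partial_r+(1-\tfrac{2M_H}{r})\partial_r\otimes\partial_r+\tfrac{1}{r^2}(\partial_\vartheta^2+\sin^{-2}\vartheta\,\partial_\varphi^2)$. On $T^*M$ with adapted coordinates $(x^\mu,p_\mu)$ set $P_0=\sqrt{-g^{\mu\nu}p_\mu p_\nu}$, $E=P_1=-p_t$, $\ell_z=P_2=p_\varphi$, $\ell=P_3=\sqrt{p_\vartheta^2+p_\varphi^2/\sin^2\vartheta}$. Dimensionless variables: $\tau=t/M_H$, $\xi=r/M_H$, $\pi_\xi=p_r/m$, $\pi_\vartheta=p_\vartheta/(M_Hm)$, $\varepsilon=E/m$, $\lambda=\ell/(M_Hm)$, $\lambda_z=\ell_z/(M_Hm)$. $U_\lambda(\xi)=(1-\tfrac2\xi)(1+\lambda^2/\xi^2)$; $\lambda_c(\varepsilon)$ ($\varepsilon>1$) is the $\lambda$ for which the maximum of $U_\lambda$ equals $\varepsilon^2$, $\lambda_c^2=12/(1-4\alpha-8\alpha^2+8\alpha\sqrt{\alpha^2+\alpha})$, $\alpha=\tfrac98\varepsilon^2-1$. $s=\sqrt{\varepsilon^2-U_\lambda(\xi)}$, $\pi_{\xi\pm}(\xi)=(\tfrac2\xi\varepsilon\pm s)/(1-\tfrac2\xi)$, $f_\pm(x)=(\tfrac2x s(x)\pm\varepsilon)/((1-\tfrac2x)s(x))$.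 $\Gamma_{accr}$: points of the future-directed timelike cotangent bundle with $\varepsilon>1$, $|\lambda_z|<\lambda$, and either (I) $\lambda<\lambda_c(\varepsilon)$, $\pi_\xi=\pi_{\xi-}(\xi)$ (absorbed), or (II) $\lambda>\lambda_c(\varepsilon)$, $\xi\ge\xi_0$, $\pi_\xi=\pi_{\xi\pm}(\xi)$, where $\xi_0$ is the turning point (root of $U_\lambda=\varepsilon^2$ beyond the maximum of $U_\lambda$) (scattered). Define $G=G_{\varepsilon,\lambda}(\xi,\pi_\xi)$ by $G=\int_2^\xi f_-(x)dx$ in case (I) (integrand extended continuously to $x=2$), and $G=\int_{\xi_0}^\xi f_\pm(x)dx$ for $\pi_\xi=\pi_{\xi\pm}$ in case (II). Define $Q^2=\varphi-\lambda_z\int_\gamma\frac{d\vartheta}{\pi_\vartheta\sin^2\vartheta}$ and $Q^3=-\lambda\int_{\xi_{ref}}^{\xi}\frac{dx}{x^2\sigma s(x)}+\lambda\int_\gamma\frac{d\vartheta}{\pi_\vartheta}$, with $\xi_{ref}=2$ (case I) or $\xi_0$ (case II), $\sigma=\pm1$ for $\pi_{\xi\pm}$, and $\gamma$ running clockwise along $\pi_\vartheta^2+\lambda_z^2/\sin^2\vartheta=\lambda^2$ from $(\pi/2,\sqrt{\lambda^2-\lambda_z^2})$ to $(\vartheta,\pi_\vartheta)$ ($Q^2,Q^3$ are defined modulo $2\pi$). Initial data: $R^{(abs)}=\{(G,Q^2,Q^3,\varepsilon,\lambda_z,\lambda):G\le0,\varepsilon>1,|\lambda_z|<\lambda<\lambda_c(\varepsilon)\}$,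 $R^{(scat)}=\{G\in\mathbb{R},\varepsilon>1,|\lambda_z|<\lambda,\lambda>\lambda_c(\varepsilon)\}$; the solution is $f(x,p)=\delta(P_0-m)\mathcal F_i^{(abs)}(G-\tau,Q^2,Q^3,\varepsilon,\lambda_z,\lambda)$ if $\lambda<\lambda_c(\varepsilon)$ and $\delta(P_0-m)\mathcal F_i^{(scat)}(G-\tau,\dots)$ if $\lambda>\lambda_c(\varepsilon)$, and $f=0$ outside $\Gamma_{accr}$. Conditions: (i) $\mathcal F_i^{(abs)},\mathcal F_i^{(scat)}$ are nonnegative, measurable, $2\pi$-periodic in $Q^2,Q^3$, and there are constants $C,b>0$ with $0\le\mathcal F_i^{(abs,scat)}\le Ce^{-b\varepsilon}$ everywhere on $R^{(abs,scat)}$. (ii) There is $f_{-\infty}:(1,\infty)\to\mathbb{R}$ with $\lim_{G\to-\infty}\mathcal F_i^{(abs)}(G,Q^2,Q^3,\varepsilon,\lambda_z,\lambda)=f_{-\infty}(\varepsilon)$ for all $Q^2,Q^3\in[0,2\pi]$, $\varepsilon>1$, $|\lambda_z|<\lambda<\lambda_c(\varepsilon)$. (iii) There is $f_{+\infty}:(1,\infty)\to\mathbb{R}$ such that for every $\varepsilon>1$, $\sup|\mathcal F_i^{(scat)}(G,Q^2,Q^3,\varepsilon,\lambda_z,\lambda)-f_{\pm\infty}(\varepsilon)|\to0$ as $G\to\pm\infty$, the supremum over $Q^2,Q^3\in[0,2\pi]$, $|\lambda_z|<\lambda$, $\lambda>\lambda_c(\varepsilon)$. Observables of a distribution $f$: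 $J(X)=\int_{T_x^*M}p(X)f\,\mathrm{dvol}_x$, $T(X,Y)=\int_{T_x^*M}p(X)p(Y)f\,\mathrm{dvol}_x$, $\mathrm{dvol}_x=\sqrt{-\det g^{\mu\nu}(x)}\,d^4p$. Frame (for $r>2M_H$, $N=1-2M_H/r$): $e_0=N^{-1/2}\partial_t$, $e_1=N^{-1/2}(\tfrac{2M_H}{r}\partial_t+N\partial_r)$, $e_2=r^{-1}\partial_\vartheta$, $e_3=(r\sin\vartheta)^{-1}\partial_\varphi$; $J_\alpha=J(e_\alpha)$, $T_{\alpha\beta}=T(e_\alpha,e_\beta)$. *)

(* Defs.v *)
From HB Require Import structures.
From mathcomp Require Import all_boot all_order all_algebra.
From mathcomp Require Import all_classical all_reals all_analysis.
Set Implicit Arguments. Unset Strict Implicit. Unset Printing Implicit Defensive.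
Import Order.TTheory GRing.Theory Num.Theory.
Import numFieldNormedType.Exports.
Local Open Scope classical_set_scope.
Local Open Scope ring_scope.

Section Defs.
Variable R : realType.

Definition leb : set (measurableTypeR R) -> \bar R := @lebesgue_measure R.
Definition mu3 := ((leb \x leb) \x leb)%E.

(* Spacetime: coordinates (t, r, th, ph); covector p = (p_t,p_r,p_th,p_ph) *)
(* indexed by 'I_4 (0 = t, 1 = r, 2 = th, 3 = ph).                      *)

(* inverse metric g^{mu nu} (with  d_t (x)_s d_r = (d_t(x)d_r + d_r(x)d_t)/2) *)
Definition ginv (M r th : R) : 'M[R]_4 :=
  \matrix_(i < 4, j < 4)
    match nat_of_ord i, nat_of_ord j with
    | 0%N, 0%N => - (1 + 2 * M / r)
    | 0%N, 1%N => 2 * M / r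
    | 1%N, 0%N => 2 * M / r
    | 1%N, 1%N => 1 - 2 * M / r
    | 2%N, 2%N => 1 / r ^+ 2
    | 3%N, 3%N => 1 / (r ^+ 2 * sin th ^+ 2)
    | _, _ => 0
    end.

Definition mom (pt pr pth pph : R) : 'I_4 -> R :=
  fun mu => match nat_of_ord mu with
            | 0%N => pt | 1%N => pr | 2%N => pth | _ => pph end.

Definition gpp (M r th : R) (p : 'I_4 -> R) : R :=
  \sum_(i < 4) \sum_(j < 4) ginv M r th i j * p i * p j.

Definition P0 (M r th : R) (p : 'I_4 -> R) : R := Num.sqrt (- gpp M r th p).

Definition pup (M r th : R) (p : 'I_4 -> R) (mu : 'I_4) : R :=
  \sum_(j < 4) ginv M r th mu j * p j.

(* future directed timelike covector: timelike, and p^sharp increases the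
   time function t (dt(p^sharp) = p^t > 0; dt is timelike for all r > 0) *)
Definition future_timelike (M r th : R) (p : 'I_4 -> R) : bool :=
  (0 < - gpp M r th p) && (0 < pup M r th p ord0).

Definition pairing (p X : 'I_4 -> R) : R := \sum_(mu < 4) p mu * X mu.

Definition frame (M r th : R) (a mu : 'I_4) : R :=
  let N := 1 - 2 * M / r in
  match nat_of_ord a, nat_of_ord mu with
  | 0%N, 0%N => 1 / Num.sqrt N
  | 1%N, 0%N => (2 * M / r) / Num.sqrt N
  | 1%N, 1%N => N / Num.sqrt N
  | 2%N, 2%N => 1 / r
  | 3%N, 3%N => 1 / (r * sin th)
  | _, _ => 0
  end.

(* Integration against  delta(P_0 - m) dvol_x  on the fibre T*_x M.     *)
(* For fixed spatial momenta (p_r,p_th,p_ph) the equation P_0 = m has  *)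
(* exactly two solutions p_t (one future, one past directed); the      *)
(* delta is resolved by the usual rule  delta(g(y)) = sum over roots   *)
(* y0 of delta(y-y0)/|g'(y0)|, integrating p_t out first.               *)
Definition pt_root (M m r th : R) (fut : bool) (pr pth pph : R) : R :=
  xget 0 [set pt | P0 M r th (mom pt pr pth pph) = m /\
                   (if fut then 0 < pup M r th (mom pt pr pth pph) ord0
                    else pup M r th (mom pt pr pth pph) ord0 < 0)].

Definition delta_weight (M r th : R) (pt pr pth pph : R) : R :=
  1 / `| derive1 (fun y => P0 M r th (mom y pr pth pph)) pt |.

(* \int_{T*_x M} delta(P_0 - m) h(p) dvol_x,  dvol_x = sqrt(-det g^{mu nu}) d^4 p,
   for a function h(p_t,p_r,p_th,p_ph) at the point x = (t,r,th,ph). *)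
Definition shell_integral (M m r th : R) (h : R -> R -> R -> R -> R) : \bar R :=
  (\int[mu3]_(q in [set: R * R * R])
     (let pr := q.1.1 in let pth := q.1.2 in let pph := q.2 in
      let ptf := pt_root M m r th true pr pth pph in
      let ptp := pt_root M m r th false pr pth pph in
      ((h ptf pr pth pph * delta_weight M r th ptf pr pth pph
        + h ptp pr pth pph * delta_weight M r th ptp pr pth pph)
       * Num.sqrt (- \det (ginv M r th)))%:E))%E.

(* Frame components of the current density and of the stress-energy tensor
   of the distribution  delta(P_0 - m) h(p)  at the point (r, th, .). *)
Definition Jcomp (M m r th : R) (h : R -> R -> R -> R -> R) (a : 'I_4) : \bar R :=
  shell_integral M m r th (fun pt pr pth pph =>
    pairing (mom pt pr pth pph) (frame M r th a) * h pt pr pth pph).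

Definition Tcomp (M m r th : R) (h : R -> R -> R -> R -> R) (a b : 'I_4) : \bar R :=
  shell_integral M m r th (fun pt pr pth pph =>
    pairing (mom pt pr pth pph) (frame M r th a)
    * pairing (mom pt pr pth pph) (frame M r th b) * h pt pr pth pph).

Definition Ueff (lam xi : R) : R := (1 - 2 / xi) * (1 + lam ^+ 2 / xi ^+ 2).

Definition lam_c (eps : R) : R :=
  let a := 9 / 8 * eps ^+ 2 - 1 in
  Num.sqrt (12 / (1 - 4 * a - 8 * a ^+ 2 + 8 * a * Num.sqrt (a ^+ 2 + a))).

Definition xi_max (lam : R) : R :=
  xget 0 [set x | 2 < x /\ forall y, 2 < y -> Ueff lam y <= Ueff lam x].

Definition xi0 (eps lam : R) : R :=
  xget 0 [set x | xi_max lam < x /\ Ueff lam x = eps ^+ 2].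

Definition sfun (eps lam x : R) : R := Num.sqrt (eps ^+ 2 - Ueff lam x).

Definition pixi (sg eps lam xi : R) : R :=
  (2 / xi * eps + sg * sfun eps lam xi) / (1 - 2 / xi).

Definition fpm (sg eps lam x : R) : R :=
  (2 / x * sfun eps lam x + sg * eps) / ((1 - 2 / x) * sfun eps lam x).

(* G in case (I):  int_2^xi f_-(x) dx  (the point x = 2 is Lebesgue-null) *)
Definition G_abs (eps lam xi : R) : R := Rintegral leb `[2, xi] (fpm (-1) eps lam).

Definition G_scat (sg eps lam xi : R) : R :=
  Rintegral leb `[xi0 eps lam, xi] (fpm sg eps lam).

Definition Q3_rad (sg xiref eps lam xi : R) : R :=
  - lam * Rintegral leb `[xiref, xi] (fun x => 1 / (x ^+ 2 * sg * sfun eps lam x)).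

(* Line integrals along the curve  pi_th^2 + lamz^2/sin^2 th = lam^2    *)
(* in the (th, pi_th)-plane, run clockwise from (pi/2, sqrt(lam^2-lamz^2)). *)
(* Parametrisation (clockwise, psi in [0, 2 pi), psi = 0 at the start):  *)
(*   cos th = - k sin psi,  pi_th = k lam cos psi / sin th,  k = sqrt(1 - lamz^2/lam^2). *)
Definition kincl (lam lamz : R) : R := Num.sqrt (1 - lamz ^+ 2 / lam ^+ 2).
Definition th_curve (k psi : R) : R := acos (- (k * sin psi)).
Definition pi_curve (lam k psi : R) : R := k * lam * cos psi / sin (th_curve k psi).

Definition psi_end (lam lamz th pth : R) : R :=
  xget 0 [set psi | 0 <= psi < 2 * pi /\
                    th_curve (kincl lam lamz) psi = th /\
                    pi_curve lam (kincl lam lamz) psi = pth].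

Definition curve_int (lam lamz th pth : R) (a : R -> R -> R) : R :=
  let k := kincl lam lamz in
  Rintegral leb `[0, psi_end lam lamz th pth]
    (fun psi => a (th_curve k psi) (pi_curve lam k psi) * derive1 (th_curve k) psi).

Definition Q2 (ph lam lamz th pth : R) : R :=
  ph - lamz * curve_int lam lamz th pth (fun th' p => 1 / (p * sin th' ^+ 2)).

Definition Q3_ang (lam lamz th pth : R) : R :=
  lam * curve_int lam lamz th pth (fun _ p => 1 / p).

(* Gamma_accr: 0 = not in Gamma_accr, 1 = case (I) (absorbed),          *)
(* 2 = case (II) with pi_xi = pi_{xi+}, 3 = case (II) with pi_xi = pi_{xi-}. *)
Definition accr_case (M m r th pt pr pth pph : R) : nat :=
  let p := mom pt pr pth pph in
  let xi := r / M in
  let eps := - pt / m in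
  let pxi := pr / m in
  let lamz := pph / (M * m) in
  let lam := Num.sqrt (pth ^+ 2 + pph ^+ 2 / sin th ^+ 2) / (M * m) in
  if future_timelike M r th p && (1 < eps) && (`|lamz| < lam) then
    if (lam < lam_c eps) && (pxi == pixi (-1) eps lam xi) then 1%N
    else if (lam_c eps < lam) && (xi0 eps lam <= xi) && (pxi == pixi 1 eps lam xi) then 2%N
    else if (lam_c eps < lam) && (xi0 eps lam <= xi) && (pxi == pixi (-1) eps lam xi) then 3%N
    else 0%N
  else 0%N.

(* The solution: f = delta(P_0 - m) * fsol. *)
Definition fsol (M m : R) (Fa Fs : R -> R -> R -> R -> R -> R -> R)
    (t r th ph pt pr pth pph : R) : R :=
  let tau := t / M in
  let xi := r / M in
  let eps := - pt / m in
  let lamz := pph / (M * m) in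
  let lam := Num.sqrt (pth ^+ 2 + pph ^+ 2 / sin th ^+ 2) / (M * m) in
  let pith := pth / (M * m) in
  let q2 := Q2 ph lam lamz th pith in
  let q3a := Q3_ang lam lamz th pith in
  match accr_case M m r th pt pr pth pph with
  | 1%N => Fa (G_abs eps lam xi - tau) q2 (Q3_rad (-1) 2 eps lam xi + q3a) eps lamz lam
  | 2%N => Fs (G_scat 1 eps lam xi - tau) q2
              (Q3_rad 1 (xi0 eps lam) eps lam xi + q3a) eps lamz lam
  | 3%N => Fs (G_scat (-1) eps lam xi - tau) q2
              (Q3_rad (-1) (xi0 eps lam) eps lam xi + q3a) eps lamz lam
  | _ => 0
  end.

(* The stationary distribution: f_st = delta(P_0 - m) * f_stat. *)
Definition f_stat (M m : R) (fm : R -> R) (r th pt pr pth pph : R) : R :=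
  if accr_case M m r th pt pr pth pph != 0%N then fm (- pt / m) else 0.

Definition R_abs (G eps lamz lam : R) : Prop :=
  G <= 0 /\ 1 < eps /\ `|lamz| < lam /\ lam < lam_c eps.
Definition R_scat (eps lamz lam : R) : Prop :=
  1 < eps /\ `|lamz| < lam /\ lam_c eps < lam.

Definition unc6 (F : R -> R -> R -> R -> R -> R -> R) (v : R * R * R * R * R * R) : R :=
  F v.1.1.1.1.1 v.1.1.1.1.2 v.1.1.1.2 v.1.1.2 v.1.2 v.2.

End Defs.

(* Main.v *)
(* Integrating out [p_t] turns every observable into an integral over the spatial
   momenta [q] of [P(q) f(q) m / W(q)], where [W] is the absolute value of [p^t] on
   the mass shell.  For fixed [q] the solution depends on the time only through
   [G - t / M], which tends to minus infinity, and periodicity in the angles removes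
   the restriction of (ii) and (iii) to a fundamental domain; so the integrand
   converges pointwise.  Outside the horizon the energy dominates [W], which in turn
   dominates the l^1 norm of [q], so the bound [C exp(- b eps)] beats the
   quadratically growing weights and the dominated convergence theorem applies.
   The delicate point is measurability: [xi0] and [psi_end] are chosen by [xget],
   and become measurable through the level sets [c < xi0] (the existence of a
   rational [y > max 2 c] with [eps^2 < Ueff lam y]) and through an [acos] formula. *)

Require Import Defs.
From HB Require Import structures.
From mathcomp Require Import all_boot all_order all_algebra.
From mathcomp Require Import all_classical all_reals all_analysis.
From mathcomp Require Import measurable_realfun ring lra.
Set Implicit Arguments. Unset Strict Implicit. Unset Printing Implicit Defensive.
Import Order.TTheory GRing.Theory Num.Theory.
Import numFieldNormedType.Exports.
Local Open Scope classical_set_scope.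
Local Open Scope ring_scope.

(** * Measurability of inversion, [acos], and integrals over moving intervals *)

Section measurability.
Context {R : realType}.

Lemma measurable_invr : measurable_fun [set: R] (@GRing.inv R).
Proof.
have -> : [set: R] = [set 0] `|` ~` [set 0] by rewrite setUv.
apply/measurable_funU; [exact: measurable_set1|exact: measurableC|].
split; first exact: measurable_fun_set1.
apply: open_continuous_measurable_fun.
  apply: closed_openC; apply: accessible_closed_set1.
  by apply: hausdorff_accessible; exact: norm_hausdorff.
by move=> x; rewrite inE => /eqP x0; exact: inv_continuous.
Qed.

Context d (T : measurableType d).
Implicit Types f g : T -> R.

Lemma measurable_funV f : measurable_fun setT f ->
  measurable_fun setT (fun x => (f x)^-1).
Proof. by move=> mf; exact: (measurableT_comp measurable_invr). Qed.

Lemma measurable_fun_sqrtr f : measurable_fun setT f ->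
  measurable_fun setT (fun x => Num.sqrt (f x)).
Proof.
move=> mf; apply: (measurableT_comp _ mf).
by apply: continuous_measurable_fun; exact: sqrt_continuous.
Qed.

(** On [[-1, 1]] monotonicity gives measurability; outside, no angle has the required cosine, so the
    choice operator returns its constant default. *)
Lemma measurable_acos : measurable_fun [set: R] (@acos R).
Proof.
have mI : measurable (`[-1, 1]%classic : set R) by exact: measurable_itv.
rewrite -(setUv `[-1, 1]%classic).
apply/measurable_funU; [exact: mI|exact: measurableC|split].
  (* Clamping extends the restriction of [acos] to a nonincreasing function on the whole line. *)
  pose clamp (x : R) := Num.max (-1) (Num.min 1 x).
  have clampI x : -1 <= clamp x <= 1.
    by rewrite /clamp le_max lexx/= ge_max ge_min lexx/= andbT; lra.
  apply: (eq_measurable_fun (fun x => acos (clamp x))) => [x|].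
    by rewrite inE/= in_itv/= => /andP[x0 x1]; rewrite /clamp min_r// max_r.
  apply: nonincreasing_measurable => // x y xy.
  rewrite leNgt; apply/negP => acos_lt.
  have [/andP[y0 ypi] cosy] := acos_def (clampI y).
  have [/andP[x0 xpi] cosx] := acos_def (clampI x).
  have := @ltr_cos R (acos (clamp x)) (acos (clamp y)).
  rewrite !in_itv/= x0 xpi y0 ypi cosx cosy acos_lt => /(_ isT isT).
  by rewrite ltNge /clamp le_max2// le_min2.
apply: (eq_measurable_fun (cst point)); last exact: measurable_cst.
move=> x; rewrite inE/= in_itv/= => xI; rewrite acos.unlock xgetPN// => y [_ cosy].
by apply: xI; rewrite -cosy cos_geN1 cos_le1.
Qed.

(** The moving bounds become a jointly measurable cut-off of the integrand on the product space.
    Tonelli then applies to the positive and negative parts separately, so parameters with a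
    divergent integral are covered too. *)
Lemma measurable_Rintegral_itv (a b : T -> R) (f : T -> R -> R) :
  measurable_fun setT a -> measurable_fun setT b ->
  measurable_fun [set: T * measurableTypeR R] (fun z => f z.1 z.2) ->
  measurable_fun setT (fun t => Rintegral (@leb R) `[a t, b t] (f t)).
Proof.
move=> ma mb mf.
pose F := fun z : T * measurableTypeR R =>
  if (a z.1 <= z.2) && (z.2 <= b z.1) then f z.1 z.2 else 0.
have mF : measurable_fun setT (EFin \o F).
  apply/measurable_EFinP; apply: measurable_fun_ifT => //.
  apply: measurable_and; apply: measurable_fun_ler => //;
    by [exact: measurableT_comp|exact: measurable_snd].
rewrite (_ : (fun t => _) = fun t => fine
    (\int[lebesgue_measure]_y (EFin \o F)^\+%E (t, y)
     - \int[lebesgue_measure]_y (EFin \o F)^\-%E (t, y))%E).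
  apply: measurableT_comp; first exact: fine_measurable.
  apply: emeasurable_funB; apply: measurable_fun_fubini_tonelli_F => //.
  - exact: measurable_funepos.
  - exact: measurable_funeneg.
apply/funext => t; rewrite /Rintegral integral_mkcond /leb integralE; congr fine.
have FE : ((fun x => (f t x)%:E) \_ `[a t, b t]%classic)%E =
    (fun y => (EFin \o F) (t, y)).
  by apply/funext => y; rewrite patchE /F/= mem_setE in_itv/=; case: ifP.
rewrite FE; congr (_ - _)%E; apply: eq_integral => y _.
  by rewrite !funeposE.
by rewrite !funenegE.
Qed.

End measurability.

(* The library's sigma-finiteness instance of [m1 \x m2] is shadowed by the one
   for subprobabilities, hence this alias carrying its own instance. *)
Definition leb2 (R : realType) :
    set (measurableTypeR R * measurableTypeR R)%type -> \bar R :=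
  (@lebesgue_measure R \x @lebesgue_measure R)%E.

HB.instance Definition _ (R : realType) := Measure.copy (@leb2 R)
  (@lebesgue_measure R \x @lebesgue_measure R)%E.

(** Squares of one increasing exhaustion cover the plane: monotonicity brings the indices of the two
    coordinates to their maximum. *)
Lemma sigma_finite_leb2 (R : realType) : sigma_finite setT (@leb2 R).
Proof.
have /sigma_finiteP[F [TF ndF Foo]] := sigma_finiteT (@lebesgue_measure R).
exists (fun n => F n `*` F n).
  rewrite -setXTT TF predeqE => -[x y]; split.
    move=> [/= [n _ Fnx] [k _ Fky]]; exists (maxn n k) => //; split => /=.
      by move: x Fnx; exact/subsetPset/ndF/leq_maxl.
    by move: y Fky; exact/subsetPset/ndF/leq_maxr.
  by move=> [n _ []/= ? ?]; split; exists n.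
move=> n; have [mF Fy] := Foo n; split; first exact: measurableX.
by rewrite /leb2 [ltLHS]product_measure1E// lte_mul_pinfty// ge0_fin_numE.
Qed.

HB.instance Definition _ (R : realType) := Measure_isSigmaFinite.Build _ _ _
  (@leb2 R) (@sigma_finite_leb2 R).

(** * Integrability of an exponential of the l^1 norm in three dimensions *)

Section exponential_bounds.
Context {R : realType}.
Variable k : R.
Hypothesis k0 : 0 < k.

Local Notation mu := (@lebesgue_measure R).

Lemma measurable_expR_norm : measurable_fun setT (fun x : R => expR (- (k * `|x|))).
Proof.
apply: measurableT_comp; first exact: measurable_expR.
apply: measurable_funN; apply: measurable_funM; first exact: measurable_cst.
exact: normr_measurable.
Qed.

(** By symmetry the half line suffices, and there the integrand is [k^-1] times the exponential
    probability density. *)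
Lemma integral_expR_norm_lty : (\int[mu]_x (expR (- (k * `|x|)))%:E < +oo)%E.
Proof.
rewrite ge0_symfun_integralT//=; last 2 first.
- move=> x; apply: continuous_comp; last exact: continuous_expR.
  apply: continuousN; apply: continuousM; first exact: cst_continuous.
  exact: norm_continuous.
- by move=> x /=; rewrite normrN.
apply: lte_mul_pinfty => //.
have -> : (\int[mu]_(x in [set x | (0 <= x)%R]) (expR (- (k * `|x|)))%:E =
    \int[mu]_(x in [set x | (0 <= x)%R]) (k^-1%:E * (exponential_pdf k x)%:E))%E.
  apply: eq_integral => x; rewrite inE/= => x0.
  rewrite exponential_pdfE//.
  by rewrite ger0_norm// -EFinM mulrA mulVf ?gt_eqF// mul1r mulNr.
apply: (@le_lt_trans _ _ (\int[mu]_x (k^-1%:E * (exponential_pdf k x)%:E))%E).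
  apply: ge0_subset_integral => //.
  - by rewrite -set_itvcy; exact: measurable_itv.
  - apply/measurable_EFinP; apply: measurable_funM => //.
    exact: measurable_exponential_pdf.
  - by move=> x _; rewrite lee_fin mulr_ge0// ?invr_ge0 ?exponential_pdf_ge0 ?ltW.
rewrite ge0_integralZl//.
- by rewrite integral_exponential_pdf// mule1 ltry.
- by apply/measurable_EFinP; exact: measurable_exponential_pdf.
- by move=> x _; rewrite lee_fin exponential_pdf_ge0// ltW.
- by rewrite lee_fin invr_ge0 ltW.
Qed.

(** Tonelli step that adds one dimension; two applications lead from the line to the three spatial
    momenta. *)
Lemma integral_prod_expR_norm_lty d (T : measurableType d)
    (m : {sigma_finite_measure set T -> \bar R}) (f : T -> R) :
  measurable_fun setT f -> (forall x, 0 <= f x) ->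
  (\int[m]_x (f x)%:E < +oo)%E ->
  (\int[m \x mu]_z (f z.1 * expR (- (k * `|z.2|)))%:E < +oo)%E.
Proof.
move=> mf f0 If.
rewrite fubini_tonelli1//=; last 2 first.
- apply/measurable_EFinP; apply: measurable_funM; first exact: measurableT_comp.
  apply: (measurableT_comp measurable_expR_norm); exact: measurable_snd.
- by move=> z; rewrite lee_fin mulr_ge0// expR_ge0.
have I0 : (0 <= \int[mu]_y (expR (- (k * `|y|)))%:E)%E.
  by apply: integral_ge0 => y _; rewrite lee_fin expR_ge0.
have -> : (\int[m]_x fubini_F mu
      (fun z : T * R => (f z.1 * expR (- (k * `|z.2|)))%:E) x =
    \int[m]_x ((f x)%:E * \int[mu]_y (expR (- (k * `|y|)))%:E))%E.
  apply: eq_integral => x _; rewrite /fubini_F/=.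
  under eq_integral do rewrite EFinM.
  rewrite ge0_integralZl//.
  - by apply/measurable_EFinP; exact: measurable_expR_norm.
  - by rewrite lee_fin.
rewrite ge0_integralZr//.
- apply: lte_mul_pinfty => //; last exact: integral_expR_norm_lty.
    by apply: integral_ge0 => x _; rewrite lee_fin.
  by rewrite ge0_fin_numE//; apply: integral_ge0 => x _; rewrite lee_fin.
- exact/measurable_EFinP.
- by move=> x _; rewrite lee_fin.
Qed.

Lemma integrable_expR_norm3 : (@leb2 R \x mu)%E.-integrable setT
  (fun q : R * R * R => (expR (- (k * (`|q.1.1| + `|q.1.2| + `|q.2|))))%:E).
Proof.
have mE := measurable_expR_norm.
have mE2 : measurable_fun [set: R * R]
    (fun z => expR (- (k * `|z.1|)) * expR (- (k * `|z.2|))).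
  apply: measurable_funM; apply: (measurableT_comp mE);
    by [exact: measurable_fst|exact: measurable_snd].
rewrite (_ : (fun q => _) = (fun q : R * R * R =>
    (expR (- (k * `|q.1.1|)) * expR (- (k * `|q.1.2|)) *
     expR (- (k * `|q.2|)))%:E)); last first.
  by apply/funext => q; rewrite -!expRD !mulrDr !opprD.
apply/integrableP; split.
  apply/measurable_EFinP; apply: measurable_funM.
    by apply: (measurableT_comp mE2); exact: measurable_fst.
  by apply: (measurableT_comp mE); exact: measurable_snd.
under eq_integral do rewrite /= ger0_norm ?mulr_ge0 ?expR_ge0//.
have I1 := integral_expR_norm_lty.
have I2 := @integral_prod_expR_norm_lty _ _ mu _ mE (fun=> expR_ge0 _) I1.
apply: (@integral_prod_expR_norm_lty _ _ (@leb2 R) _ mE2 _ I2) => z.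
by rewrite mulr_ge0 ?expR_ge0.
Qed.

End exponential_bounds.

(** * The turning point [xi0] and its measurability *)

Section turning_point.
Context {R : realType}.
Implicit Types l e x u : R.

(* [Ueff l x] is the cubic [(1 - 2 u) (1 + l^2 u^2)] in [u = 1 / x]. *)
Let p l u := (1 - 2 * u) * (1 + l ^+ 2 * u ^+ 2).

Lemma Ueff_cubic l x : Ueff l x = p l x^-1.
Proof. by rewrite /Ueff /p exprVn. Qed.

(** Minus the divided difference of the cubic between [u0] and [u], a quadratic in [u]. *)
Let q l u0 u :=
  2 * l ^+ 2 * (u ^+ 2 + u * u0 + u0 ^+ 2) - l ^+ 2 * (u + u0) + 2.

Lemma cubic_factor l u0 u : p l u - p l u0 = - (u - u0) * q l u0 u.
Proof. by rewrite /p /q; ring. Qed.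

Lemma Ueff_le0 l x : 0 < x <= 2 -> Ueff l x <= 0.
Proof.
move=> /andP[x0 x2]; rewrite /Ueff mulr_le0_ge0//.
  by rewrite subr_le0 ler_pdivlMr// mul1r.
by rewrite addr_ge0// mulr_ge0 ?invr_ge0 ?sqr_ge0.
Qed.

Definition is_xi_max l x := 2 < x /\ forall y, 2 < y -> Ueff l y <= Ueff l x.

(** This includes the case without a maximum, where [xget] returns [0]. *)
Lemma xi_max_ge0 l : 0 <= xi_max l.
Proof.
rewrite /xi_max; case: xgetP => // x _ [x2 _].
by rewrite ltW// (lt_trans _ x2).
Qed.

Lemma continuous_cubic l : continuous (p l).
Proof.
move=> u; apply: cvgM.
  by apply: cvgB; [exact: cvg_cst|apply: cvgM; [exact: cvg_cst|exact: cvg_id]].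
apply: cvgD; first exact: cvg_cst.
by apply: cvgM; [exact: cvg_cst|exact: exprn_continuous].
Qed.

Lemma invr_lt_half x : 2 < x -> 0 < x^-1 < 2^-1.
Proof.
move=> x2; have x0 : 0 < x by rewrite (lt_trans _ x2).
by rewrite invr_gt0 x0/= ltf_pV2// posrE.
Qed.

(** In [u = 1 / x] the exterior region becomes the bounded interval from [0] to [1/2]. The cubic is
    [1] at [0] and [0] at [1/2], so a value above [1] forces its maximum into the interior, that is,
    to some [x > 2]. *)
Lemma is_xi_maxP l y : 2 < y -> 1 < Ueff l y -> is_xi_max l (xi_max l).
Proof.
move=> y2 Uy.
suff [x mx] : exists x, is_xi_max l x.
  by rewrite /xi_max; case: xgetP => [z _ //|/(_ x)].
have half0 : 0 <= 2^-1 :> R by rewrite invr_ge0.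
have [u uI umax] := EVT_max half0 (continuous_subspaceT (@continuous_cubic l)).
have pu z : 2 < z -> Ueff l z <= p l u.
  move=> /invr_lt_half/andP[z0 z2]; rewrite Ueff_cubic; apply: umax.
  by rewrite in_itv/= !ltW.
have pu1 : 1 < p l u by rewrite (lt_le_trans Uy) ?pu.
move: uI; rewrite in_itv/= => /andP[u0 u2].
have {}u0 : 0 < u.
  rewrite lt_neqAle u0 andbT; apply/eqP => u0'.
  by move: pu1; rewrite -u0' /p; lra.
have {}u2 : u < 2^-1.
  rewrite lt_neqAle u2 andbT; apply/eqP => u2'.
  by move: pu1; rewrite u2' /p mulfV ?subrr ?mul0r ?ltr10.
exists u^-1; split; first by rewrite -(invrK 2) ltf_pV2 ?posrE ?invr_gt0.
by move=> z z2; rewrite [leRHS]Ueff_cubic invrK pu.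
Qed.

Section root.
Variables e l x : R.
Hypotheses (e1 : 1 < e) (mx : xi_max l < x) (Ux : Ueff l x = e ^+ 2).

Lemma xi_max_root : is_xi_max l (xi_max l).
Proof.
have e21 : 1 < e ^+ 2 by rewrite expr_gt1// ltW// (lt_trans _ e1).
have x0 : 0 < x by rewrite (le_lt_trans (xi_max_ge0 l)).
apply: (@is_xi_maxP l x); last by rewrite Ux.
rewrite ltNge; apply/negP => x2.
have : Ueff l x <= 0 by rewrite Ueff_le0 // x0.
by rewrite Ux; lra.
Qed.

(* The quadratic [q] is convex, negative at [0] and nonpositive at the maximum
   [v] of the cubic, so [e^2 - Ueff] has the sign of [u0 - u] left of [v]. *)
Lemma cubic_sign u : 0 < u < (xi_max l)^-1 ->
  q l x^-1 u < 0.
Proof.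
have [m2 mmax] := xi_max_root.
have m0 : 0 < xi_max l by rewrite (lt_trans _ m2).
have x0 : 0 < x by rewrite (lt_trans m0).
move: m2; set v := (xi_max l)^-1; set u0 := x^-1 => m2 /andP[ugt0 uv].
have u0_gt0 : 0 < u0 by rewrite invr_gt0.
have u0v : u0 < v by rewrite ltf_pV2 ?posrE.
have pu0 : p l u0 = e ^+ 2 by rewrite -Ueff_cubic.
have pv : e ^+ 2 <= p l v.
  by rewrite -Ueff_cubic -Ux mmax// (lt_trans m2).
have e21 : 1 < e ^+ 2 by rewrite expr_gt1// ltW// (lt_trans _ e1).
(* At infinity, [u = 0], the potential is [1], which is below [e ^+ 2]. *)
have q0 : q l u0 0 < 0.
  rewrite -(pmulr_rlt0 _ u0_gt0); have := cubic_factor l u0 0.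
  rewrite pu0 sub0r opprK => <-; rewrite /p; lra.
have qv : q l u0 v <= 0.
  rewrite -(pmulr_rle0 _ (_ : 0 < v - u0)) ?subr_gt0//.
  have := cubic_factor l u0 v; rewrite pu0 mulNr => h; lra.
have v0 : 0 < v by rewrite (lt_trans u0_gt0).
rewrite -(pmulr_rlt0 _ v0).
(* Convexity made explicit: the chord between [0] and [v], minus a nonnegative multiple of the
   leading coefficient [2 * l ^+ 2]. *)
have -> : v * q l u0 u = (v - u) * q l u0 0 + u * q l u0 v
    - 2 * l ^+ 2 * (u * v * (v - u)) by rewrite /q; ring.
have : (v - u) * q l u0 0 < 0 by rewrite pmulr_rlt0// subr_gt0.
have : u * q l u0 v <= 0 by rewrite pmulr_rle0.
have : 0 <= 2 * l ^+ 2 * (u * v * (v - u)).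
  apply: mulr_ge0; first by rewrite mulr_ge0 ?sqr_ge0.
  by rewrite mulr_ge0 ?subr_ge0 ?mulr_ge0 ?ltW.
lra.
Qed.

(** From the root outwards the factors [u - u0] and [q] are both nonpositive, which keeps the
    potential at or below [e ^+ 2]. *)
Lemma lt_root y : 2 < y -> e ^+ 2 < Ueff l y -> y < x.
Proof.
move=> y2 Uy; rewrite ltNge; apply/negP => xy.
have m2 := xi_max_root.1.
have m0 : 0 < xi_max l by rewrite (lt_trans _ m2).
have x0 : 0 < x by rewrite (lt_trans m0).
have y0 : 0 < y by rewrite (lt_le_trans x0).
have qy : q l x^-1 y^-1 < 0.
  by apply: cubic_sign; rewrite invr_gt0 y0 ltf_pV2 ?posrE// (lt_le_trans mx).
have := cubic_factor l x^-1 y^-1; rewrite -!Ueff_cubic Ux.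
have : y^-1 <= x^-1 by rewrite lef_pV2 ?posrE.
by move=> yx h; have : - (y^-1 - x^-1) * q l x^-1 y^-1 <= 0; [nra|lra].
Qed.

(** Strictly between the maximum and the root the potential exceeds [e ^+ 2]. A rational witness
    turns the level sets of [xi0] into countable unions. *)
Lemma root_gt c : c < x -> exists r : rat,
  [/\ 2 < ratr r :> R, c < ratr r & e ^+ 2 < Ueff l (ratr r)].
Proof.
move=> cx; have m2 := xi_max_root.1.
have m0 : 0 < xi_max l by rewrite (lt_trans _ m2).
have [|r] := @rat_in_itvoo R (Num.max c (xi_max l)) x.
  by rewrite gt_max cx.
rewrite in_itv/= gt_max => /andP[/andP[cr mr] rx]; exists r; split => //.
  exact: lt_trans mr.
have r0 : 0 < ratr r :> R by rewrite (lt_trans m0).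
have x0 : 0 < x by rewrite (lt_trans m0).
have qr : q l x^-1 (ratr r)^-1 < 0.
  by apply: cubic_sign; rewrite invr_gt0 r0 ltf_pV2 ?posrE.
have := cubic_factor l x^-1 (ratr r)^-1; rewrite -!Ueff_cubic Ux.
have : x^-1 < (ratr r)^-1 by rewrite ltf_pV2 ?posrE.
by move=> yx h; have : 0 < - ((ratr r)^-1 - x^-1) * q l x^-1 (ratr r)^-1; [nra|lra].
Qed.

End root.

(** Intermediate values of the cubic between [u = 0], where it is [1], and the inverse of the
    maximum point, where it exceeds [e ^+ 2]. *)
Lemma root_exists e l y : 1 < e -> 2 < y -> e ^+ 2 < Ueff l y ->
  exists x, xi_max l < x /\ Ueff l x = e ^+ 2.
Proof.
move=> e1 y2 Uy.
have e21 : 1 < e ^+ 2 by rewrite expr_gt1// ltW// (lt_trans _ e1).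
have [m2 mmax] := is_xi_maxP y2 (lt_trans e21 Uy).
have /andP[v0 _] := invr_lt_half m2.
have pv : e ^+ 2 < p l (xi_max l)^-1.
  by rewrite -Ueff_cubic (lt_le_trans Uy)// mmax.
have p0 : p l 0 = 1 by rewrite /p; ring.
have [|u] := @IVT R (p l) 0 (xi_max l)^-1 (e ^+ 2) (ltW v0)
  (continuous_subspaceT (@continuous_cubic l)).
  by rewrite p0 ge_min le_max (ltW e21) (ltW pv) orbT.
rewrite in_itv/= => /andP[u0 uv] pu; exists u^-1.
have {}u0 : 0 < u.
  rewrite lt_neqAle u0 andbT; apply/eqP => u0'.
  by move: pu; rewrite -u0' p0 => h; move: e21; rewrite -h ltxx.
have {}uv : u < (xi_max l)^-1.
  rewrite lt_neqAle uv andbT; apply/eqP => uv'.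
  by move: pv; rewrite -uv' pu ltxx.
split; last by rewrite Ueff_cubic invrK.
by rewrite -(invrK (xi_max l)) ltf_pV2 ?posrE.
Qed.

Lemma xi0_ge0 e l : 0 <= xi0 e l.
Proof.
rewrite /xi0; case: xgetP => // x _ [mx _].
by rewrite ltW// (le_lt_trans (xi_max_ge0 l)).
Qed.

(** Without a root, [xi0] is [0] and both sides fail since [0 <= c]; thus the right-hand side also
    detects that a root exists. *)
Lemma xi0_gtP e l c : 1 < e -> 0 <= c -> c < xi0 e l <->
  exists r : rat, [/\ 2 < ratr r :> R, c < ratr r & e ^+ 2 < Ueff l (ratr r)].
Proof.
move=> e1 c0; split.
  rewrite /xi0; case: xgetP => [x _ [mx Ux]|_]; last by rewrite ltNge c0.
  exact: root_gt.
move=> [r [r2 cr Ur]]; rewrite (lt_trans cr)// /xi0; case: xgetP => [x _ [mx Ux]|].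
  exact: (lt_root e1 mx Ux).
by have [x rx] := root_exists e1 r2 Ur => /(_ x).
Qed.

Lemma measurable_xi0 d (T : measurableType d) (e l : T -> R) :
  measurable_fun setT e -> measurable_fun setT l ->
  measurable_fun setT (fun t => if 1 < e t then xi0 (e t) (l t) else 0).
Proof.
move=> me ml; apply: (measurability (@RGenOInfty.G R)).
  exact: RGenOInfty.measurableE.
move=> _ [_] [c] -> <-; rewrite setTI.
(* For negative [c] the level set is the whole space, all values being nonnegative. *)
have [c0|c0] := ltP c 0.
  rewrite [X in measurable X](_ : _ = setT)//; apply/seteqP; split => // t _ /=.
  by rewrite in_itv/= andbT (lt_le_trans c0)//; case: ifP => // _; exact: xi0_ge0.
have mU (r : rat) : measurable_fun setT (fun t => Ueff (l t) (ratr r)).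
  apply: measurable_funM => //; apply: measurable_funD => //.
  by apply: measurable_funM => //; exact: measurable_funX.
rewrite [X in measurable X](_ : _ = [set t | 1 < e t] `&` \bigcup_(r : rat)
    ([set t | (2 < ratr r :> R) && (c < ratr r)] `&`
     [set t | e t ^+ 2 < Ueff (l t) (ratr r)])); last first.
  apply/seteqP; split => t /=; rewrite in_itv/= andbT.
    case: ifPn => [e1|_]; last by rewrite ltNge c0.
    move=> /(xi0_gtP _ e1 c0)[r [r2 cr Ur]]; split => //; exists r => //.
    by split => //=; rewrite r2.
  move=> [e1 [r _ [/andP[r2 cr] Ur]]]; rewrite e1; apply/xi0_gtP => //.
  by exists r.
apply: measurableI.
  by rewrite -[X in measurable X]setTI; exact: measurable_fun_ltr.
apply: bigcupT_measurable_rat => r; apply: measurableI.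
  by case: (_ && _); rewrite ?set_true ?set_false.
rewrite -[X in measurable X]setTI; apply: measurable_fun_ltr => //.
exact: measurable_funX.
Qed.

End turning_point.

(** * The angle along the orbit in the [(th, pi_th)] plane *)

Section orbital_angle.
Context {R : realType}.
Implicit Types k lam lamz th pth psi : R.

(** On the lower half circle, reflection to [2 * pi - psi] keeps the cosine and lands in the range
    of [acos]. *)
Lemma angle_eq psi : 0 <= psi < 2 * pi ->
  psi = if 0 <= sin psi then acos (cos psi) else 2 * pi - acos (cos psi).
Proof.
move=> /andP[psi0 psi2]; have [psi_pi|pi_psi] := leP psi pi.
  by rewrite sin_ge0_pi ?psi0// cosK// in_itv/= psi0.
have sinE : sin (2 * pi - psi) = - sin psi.
  by rewrite -sinN -[RHS]sinD2pi addrC mulr_natl.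
have cosE : cos (2 * pi - psi) = cos psi.
  by rewrite -[RHS]cosN -[RHS]cosD2pi addrC mulr_natl.
have : 0 < sin (2 * pi - psi) by apply: sin_gt0_pi; apply/andP; split; lra.
rewrite sinE oppr_gt0 leNgt => ->; rewrite -cosE cosK ?subKr//.
by rewrite in_itv/=; apply/andP; split; lra.
Qed.

Lemma angle_exists (c s : R) : c ^+ 2 + s ^+ 2 = 1 ->
  exists psi, [/\ 0 <= psi < 2 * pi, cos psi = c & sin psi = s].
Proof.
move=> cs1; have cI : -1 <= c <= 1.
  by rewrite -ler_norml -(@expr_le1 _ 2)// real_normK ?num_real//; nra.
have [/andP[a0 api] cosa] := acos_def cI.
have sina : sin (acos c) = `|s|.
  by rewrite sin_acos// (_ : 1 - c ^+ 2 = s ^+ 2) ?sqrtr_sqr//; lra.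
have pi0 := @pi_gt0 R; have [s0|s0] := leP 0 s.
  exists (acos c); split => //; first by apply/andP; split; lra.
  by rewrite sina ger0_norm.
have c1 : c < 1 by rewrite lt_neqAle (andP cI).2 andbT; apply/eqP => c1; nra.
have a_gt0 : 0 < acos c by rewrite acos_gt0// (andP cI).1.
exists (2 * pi - acos c); split.
- by apply/andP; split; lra.
- by rewrite -[RHS]cosa -[RHS]cosN -[RHS]cosD2pi addrC mulr_natl.
- rewrite -(opprK s) -(ltr0_norm s0) -sina -sinN -[RHS]sinD2pi.
  by rewrite addrC mulr_natl.
Qed.

Lemma kincl_bounds lam lamz : `|lamz| < lam -> 0 < kincl lam lamz <= 1.
Proof.
move=> lz; have lam0 : 0 < lam by rewrite (le_lt_trans _ lz).
have lz2 : lamz ^+ 2 / lam ^+ 2 < 1.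
  rewrite ltr_pdivrMr ?exprn_gt0// mul1r -[ltLHS]real_normK ?num_real//.
  by rewrite ltrXn2r// ?nnegrE// ltW.
rewrite /kincl sqrtr_gt0 subr_gt0 lz2/= -[leRHS]sqrtr1 ler_wsqrtr//.
by rewrite lerBlDr lerDl divr_ge0 ?sqr_ge0.
Qed.

Lemma kincl_sqr lam lamz : `|lamz| < lam ->
  (kincl lam lamz * lam) ^+ 2 = lam ^+ 2 - lamz ^+ 2.
Proof.
move=> lz; have lam0 : 0 < lam by rewrite (le_lt_trans _ lz).
have /andP[k0 _] := kincl_bounds lz.
rewrite exprMn sqr_sqrtr; last first.
  by move: k0; rewrite /kincl sqrtr_gt0 => /ltW.
by rewrite mulrBl mul1r divfK// gt_eqF// exprn_gt0.
Qed.

Lemma sin_norm_le1 psi : `|sin psi| <= 1.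
Proof. by rewrite ler_norml sin_geN1 sin_le1. Qed.

Lemma ksin_bounds k psi : 0 < k <= 1 -> -1 <= - (k * sin psi) <= 1.
Proof.
move=> /andP[k0 k1]; rewrite -ler_norml normrN normrM gtr0_norm//.
by rewrite mulr_ile1 ?sin_norm_le1// ltW.
Qed.

(** The end point of the curve has [sin psi = - cos th / k] and
    [cos psi = pth * sin th / (k * lam)]; the sign of the sine, opposite to that of [cos th],
    selects the branch of [acos]. *)
Definition psi_endE lam lamz th pth : R :=
  let a := acos (pth * sin th / (kincl lam lamz * lam)) in
  if cos th <= 0 then a else 2 * pi - a.

(** The relation for [lam ^+ 2] puts [(th, pth)] on the curve, so the prescribed cosine and sine lie
    on the unit circle and the set from which [psi_end] is chosen is a singleton. *)
Lemma psi_end_eq lam lamz th pth : `|lamz| < lam -> 0 < th < pi ->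
  lam ^+ 2 = pth ^+ 2 + lamz ^+ 2 / sin th ^+ 2 ->
  psi_end lam lamz th pth = psi_endE lam lamz th pth.
Proof.
move=> lz thI lamE; have lam0 : 0 < lam by rewrite (le_lt_trans _ lz).
have kI := kincl_bounds lz; have /andP[k0 _] := kI.
have sth : 0 < sin th by exact: sin_gt0_pi.
set k := kincl lam lamz in kI k0 *.
pose c := pth * sin th / (k * lam); pose s := - cos th / k.
have in_setP psi : 0 <= psi < 2 * pi /\ th_curve k psi = th /\
    pi_curve lam k psi = pth <->
    [/\ 0 <= psi < 2 * pi, cos psi = c & sin psi = s].
  rewrite /pi_curve; split => [[psiI [thE]]|[psiI cosE sinE]].
    rewrite thE => piE; split => //.
      by rewrite /c -piE divfK ?gt_eqF// mulrAC mulfV ?mul1r// gt_eqF// mulr_gt0.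
    rewrite /s -thE acosK ?in_itv/= ?ksin_bounds// opprK mulrAC mulfV ?mul1r//.
    by rewrite gt_eqF.
  have thE : th_curve k psi = th.
    rewrite /th_curve sinE /s mulrCA mulfV ?gt_eqF// mulr1 opprK cosK//.
    by rewrite in_itv/= !ltW//; case/andP: thI.
  split => //; split => //; rewrite thE cosE /c.
  by field; rewrite !gt_eqF.
have cs1 : c ^+ 2 + s ^+ 2 = 1.
  have kl0 : (k * lam) ^+ 2 != 0 by rewrite expf_neq0// gt_eqF// mulr_gt0.
  have -> : c ^+ 2 + s ^+ 2 =
      (pth ^+ 2 * sin th ^+ 2 + cos th ^+ 2 * lam ^+ 2) / (k * lam) ^+ 2.
    by rewrite /c /s; field; rewrite !gt_eqF.
  apply: (canLR (mulfK kl0)); rewrite mul1r kincl_sqr// cos2sin2 lamE.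
  by field; rewrite gt_eqF.
have psiE psi : [/\ 0 <= psi < 2 * pi, cos psi = c & sin psi = s] ->
    psi = psi_endE lam lamz th pth.
  move=> [psiI cosE sinE]; rewrite (angle_eq psiI) cosE sinE /psi_endE.
  by rewrite /s pmulr_lge0 ?invr_gt0// oppr_ge0.
rewrite /psi_end; case: xgetP => [psi _ /in_setP/psiE//|noset].
have [psi /in_setP psiI] := angle_exists cs1.
by have := noset psi.
Qed.

(** Away from the turning points in latitude the argument of [acos] stays strictly inside [(-1, 1)],
    where [acos] is differentiable. *)
Lemma cos_neq0_ksin k psi : 0 < k <= 1 -> cos psi != 0 ->
  0 < 1 - (k * sin psi) ^+ 2.
Proof.
move=> /andP[k0 k1] cosN0.
have : 0 < cos psi ^+ 2 by rewrite exprn_even_gt0.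
have := cos2Dsin2 psi; have := sqr_ge0 (sin psi).
have k21 : k ^+ 2 <= 1 by rewrite expr_le1// ltW.
have k20 := sqr_ge0 k.
by rewrite exprMn; nra.
Qed.

Lemma derive1_th_curve k psi : 0 < k <= 1 -> cos psi != 0 ->
  derive1 (th_curve k) psi = k * cos psi / Num.sqrt (1 - (k * sin psi) ^+ 2).
Proof.
move=> kI cosN0; have := cos_neq0_ksin kI cosN0.
set y := - (k * sin psi) => y1.
have yI : -1 < y < 1.
  by rewrite -ltr_norml -(@expr_lt1 _ 2)// real_normK ?num_real// /y sqrrN; lra.
have dacos : is_derive y 1 (@acos R) (- (Num.sqrt (1 - y ^+ 2))^-1).
  exact: is_derive1_acos.
have dsin : is_derive psi 1 (fun x : R => - (k * sin x)) (- (k * cos psi)).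
  by apply: is_deriveN; apply: is_deriveZ.
have := @is_derive1_comp R (@acos R) (fun x => - (k * sin x)) psi _ _ dacos dsin.
rewrite derive1E => d.
have -> : th_curve k = (@acos R) \o (fun x : R => - (k * sin x)) by [].
by rewrite (derive_val (is_derive := d)) mulrNN mulrC /y sqrrN.
Qed.

Lemma sin_th_curve k psi : 0 < k <= 1 ->
  sin (th_curve k psi) = Num.sqrt (1 - (k * sin psi) ^+ 2).
Proof. by move=> kI; rewrite sin_acos ?ksin_bounds// sqrrN. Qed.

(** The parameter [psi] is proportional to the orbital time: [d th / pi_th] has constant density
    [1 / lam]. At [cos psi = 0] the momentum vanishes and the convention [0^-1 = 0] gives the value
    [0]. *)
Lemma curve_integrand lam k psi : 0 < lam -> 0 < k <= 1 ->
  1 / pi_curve lam k psi * derive1 (th_curve k) psi =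
  if cos psi == 0 then 0 else lam^-1.
Proof.
move=> lam0 kI; rewrite /pi_curve sin_th_curve//.
case: eqP => [->|/eqP cosN0]; first by rewrite mulr0 mul0r invr0 mulr0 mul0r.
have s0 : Num.sqrt (1 - (k * sin psi) ^+ 2) != 0.
  by rewrite gt_eqF// sqrtr_gt0 cos_neq0_ksin.
rewrite derive1_th_curve//; case/andP: kI => k0 _.
by field; rewrite s0 cosN0 !gt_eqF.
Qed.

(** Eliminates the derivative of the curve, leaving an integrand that is visibly measurable jointly
    in [psi] and the parameters. *)
Lemma Q3_angE lam lamz th pth : `|lamz| < lam ->
  Q3_ang lam lamz th pth = lam * Rintegral (@leb R)
    `[0, psi_end lam lamz th pth] (fun psi => if cos psi == 0 then 0 else lam^-1).
Proof.
move=> lz; have lam0 : 0 < lam by rewrite (le_lt_trans _ lz).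
congr (_ * Rintegral _ _ _); apply/funext => psi.
by rewrite curve_integrand// kincl_bounds.
Qed.

Lemma Q2E ph lam lamz th pth : `|lamz| < lam ->
  Q2 ph lam lamz th pth = ph - lamz * Rintegral (@leb R)
    `[0, psi_end lam lamz th pth]
    (fun psi => (if cos psi == 0 then 0 else lam^-1) /
                (1 - (kincl lam lamz * sin psi) ^+ 2)).
Proof.
move=> lz; have lam0 : 0 < lam by rewrite (le_lt_trans _ lz).
have kI := kincl_bounds lz.
congr (_ - _ * Rintegral _ _ _); apply/funext => psi.
rewrite -(curve_integrand psi lam0 kI) sin_th_curve//.
case: (eqVneq (cos psi) 0) => [cos0|cosN0].
  by rewrite /pi_curve cos0 mulr0 !mul0r invr0 mulr0 !mul0r.
rewrite sqr_sqrtr ?ltW ?cos_neq0_ksin// !div1r invfM.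
by rewrite mulrAC.
Qed.

Section measurable_angles.
Context d (T : measurableType d) (lam lamz pth : T -> R).
Hypotheses (mlam : measurable_fun setT lam) (mlamz : measurable_fun setT lamz)
  (mpth : measurable_fun setT pth).

Lemma measurable_kincl : measurable_fun setT (fun t => kincl (lam t) (lamz t)).
Proof.
apply: measurable_fun_sqrtr; apply: measurable_funB => //.
apply: measurable_funM; first exact: measurable_funX.
by apply: measurable_funV; exact: measurable_funX.
Qed.

Lemma measurable_psi_endE th :
  measurable_fun setT (fun t => psi_endE (lam t) (lamz t) th (pth t)).
Proof.
have ma : measurable_fun setT (fun t =>
    acos (pth t * sin th / (kincl (lam t) (lamz t) * lam t))).
  apply: (measurableT_comp measurable_acos).
  apply: measurable_funM; first exact: measurable_funM.
  by apply: measurable_funV; apply: measurable_funM => //; exact: measurable_kincl.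
by rewrite /psi_endE; case: (cos th <= 0) => //; exact: measurable_funB.
Qed.

Lemma measurable_cos0 (f : T -> R) : measurable_fun setT f ->
  measurable_fun [set: T * measurableTypeR R]
    (fun z => if cos z.2 == 0 then 0 else f z.1).
Proof.
move=> mf; apply: measurable_fun_ifT => //; last exact: measurableT_comp.
apply: measurable_fun_eqr => //; apply: (measurableT_comp _ measurable_snd).
by apply: continuous_measurable_fun; exact: continuous_cos.
Qed.

Lemma measurable_curve_int3 th : measurable_fun setT (fun t => lam t *
  Rintegral (@leb R) `[0, psi_endE (lam t) (lamz t) th (pth t)]
    (fun psi => if cos psi == 0 then 0 else (lam t)^-1)).
Proof.
apply: measurable_funM => //.
apply: (@measurable_Rintegral_itv _ _ _ (cst 0) _
  (fun t psi => if cos psi == 0 then 0 else (lam t)^-1)) => //.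
  exact: measurable_psi_endE.
by apply: (measurable_cos0 (f := fun t => (lam t)^-1)); exact: measurable_funV.
Qed.

Lemma measurable_curve_int2 ph th : measurable_fun setT (fun t => ph - lamz t *
  Rintegral (@leb R) `[0, psi_endE (lam t) (lamz t) th (pth t)]
    (fun psi => (if cos psi == 0 then 0 else (lam t)^-1) /
                (1 - (kincl (lam t) (lamz t) * sin psi) ^+ 2))).
Proof.
apply: measurable_funB => //; apply: measurable_funM => //.
apply: (@measurable_Rintegral_itv _ _ _ (cst 0) _
  (fun t psi => (if cos psi == 0 then 0 else (lam t)^-1) /
                (1 - (kincl (lam t) (lamz t) * sin psi) ^+ 2))) => //.
  exact: measurable_psi_endE.
apply: measurable_funM.
  by apply: (measurable_cos0 (f := fun t => (lam t)^-1)); exact: measurable_funV.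
apply: measurable_funV; apply: measurable_funB => //; apply: measurable_funX.
apply: measurable_funM; first exact: measurableT_comp measurable_kincl _.
apply: (measurableT_comp _ measurable_snd).
by apply: continuous_measurable_fun; exact: continuous_sin.
Qed.

End measurable_angles.
End orbital_angle.

(** * The mass shell: roots in [p_t], weight of the delta, and growth bounds *)

Section mass_shell.
Context {R : realType}.
Variables M m r th : R.
Hypotheses (M0 : 0 < M) (m0 : 0 < m) (Mr : 2 * M < r) (thI : 0 < th < pi).
Implicit Types pt pr pth pph : R.

Let B := 2 * M / r.
Let ang pth pph := pth ^+ 2 / r ^+ 2 + pph ^+ 2 / (r ^+ 2 * sin th ^+ 2).

Let r0 : 0 < r.
Proof. by rewrite (lt_trans _ Mr)// mulr_gt0. Qed.

Let sth : 0 < sin th.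
Proof. exact: sin_gt0_pi. Qed.

Let B0 : 0 < B.
Proof. by rewrite divr_gt0 ?mulr_gt0. Qed.

Let B1 : B < 1.
Proof. by rewrite ltr_pdivrMr// mul1r. Qed.

Let ang_ge0 pth pph : 0 <= ang pth pph.
Proof.
by apply: addr_ge0; apply: divr_ge0; rewrite ?sqr_ge0// mulr_ge0 ?sqr_ge0.
Qed.

Let m2 : 0 <= m ^+ 2. Proof. exact: sqr_ge0. Qed.
Let BD : 0 <= 1 + B. Proof. by rewrite addr_ge0// ltW. Qed.

(* The absolute value of [p^t] on the mass shell. *)
Definition shell_speed pr pth pph : R :=
  Num.sqrt (pr ^+ 2 + (1 + B) * (ang pth pph + m ^+ 2)).
Local Notation W := shell_speed.

Lemma shell_speed_sqr pr pth pph :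
  W pr pth pph ^+ 2 = pr ^+ 2 + (1 + B) * (ang pth pph + m ^+ 2).
Proof.
by rewrite sqr_sqrtr// addr_ge0 ?sqr_ge0// mulr_ge0// addr_ge0.
Qed.

Lemma shell_speed_ge0 pr pth pph : 0 <= W pr pth pph.
Proof. exact: sqrtr_ge0. Qed.

Let le_shell_speed x pr pth pph : x ^+ 2 <= W pr pth pph ^+ 2 ->
  `|x| <= W pr pth pph.
Proof.
move=> xW; rewrite -(@ler_pXn2r _ 2) ?nnegrE ?shell_speed_ge0//.
by rewrite real_normK ?num_real.
Qed.

Lemma shell_speed_ge_mass pr pth pph : m <= W pr pth pph.
Proof.
rewrite -(gtr0_norm m0) le_shell_speed// shell_speed_sqr.
have := sqr_ge0 pr; have := ang_ge0 pth pph; have := B0; have := m2.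
by move=> ? ? ? ?; nra.
Qed.

Lemma shell_speed_gt0 pr pth pph : 0 < W pr pth pph.
Proof. exact: lt_le_trans m0 (shell_speed_ge_mass _ _ _). Qed.

Lemma shell_speed_ge_r pr pth pph : `|pr| <= W pr pth pph.
Proof.
rewrite le_shell_speed// shell_speed_sqr lerDl mulr_ge0//.
by rewrite addr_ge0.
Qed.

Let ang_le pr pth pph : ang pth pph <= W pr pth pph ^+ 2.
Proof.
rewrite shell_speed_sqr.
have := sqr_ge0 pr; have := ang_ge0 pth pph; have := B0; have := m2.
by move=> ? ? ? ?; nra.
Qed.

Lemma shell_speed_ge_th pr pth pph : `|pth / r| <= W pr pth pph.
Proof.
apply: le_shell_speed; apply: le_trans (ang_le _ _ _).
rewrite expr_div_n lerDl; apply: divr_ge0; first exact: sqr_ge0.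
by rewrite mulr_ge0 ?sqr_ge0.
Qed.

Lemma shell_speed_ge_ph pr pth pph : `|pph / (r * sin th)| <= W pr pth pph.
Proof.
apply: le_shell_speed; apply: le_trans (ang_le _ _ _).
by rewrite expr_div_n exprMn lerDr divr_ge0 ?sqr_ge0.
Qed.

(** Each angular component costs a factor [r], as [sin th <= 1]; the radial one costs [1]. *)
Lemma shell_speed_ge_norm1 pr pth pph :
  `|pr| + `|pth| + `|pph| <= (1 + 2 * r) * W pr pth pph.
Proof.
have h1 := shell_speed_ge_r pr pth pph.
have h2 : `|pth| <= r * W pr pth pph.
  rewrite mulrC -ler_pdivrMr// -[X in _ / X](gtr0_norm r0) -normf_div.
  exact: shell_speed_ge_th.
have h3 : `|pph| <= r * W pr pth pph.
  apply: (@le_trans _ _ (r * sin th * W pr pth pph)).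
    rewrite mulrC -ler_pdivrMr ?mulr_gt0//.
    rewrite -[X in _ / X](gtr0_norm (mulr_gt0 r0 sth)) -normf_div.
    exact: shell_speed_ge_ph.
  by rewrite ler_wpM2r ?shell_speed_ge0// ger_pMr// sin_le1.
by rewrite mulrDl mul1r; lra.
Qed.

Lemma gppE pt pr pth pph : gpp M r th (mom pt pr pth pph) =
  - (1 + B) * pt ^+ 2 + 2 * B * pt * pr + (1 - B) * pr ^+ 2 + ang pth pph.
Proof.
rewrite /gpp !big_ord_recl !big_ord0 /ginv !mxE /mom /=.
by rewrite -/B /ang; ring.
Qed.

Lemma pupE pt pr pth pph :
  pup M r th (mom pt pr pth pph) ord0 = - (1 + B) * pt + B * pr.
Proof.
rewrite /pup !big_ord_recl !big_ord0 /ginv !mxE /mom /=.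
by rewrite -/B; ring.
Qed.

(** Completing the square in [p_t] gives [(p^t)^2 - W^2 = (1 + B) * (- gpp - m^2)]. *)
Lemma mass_shellE pt pr pth pph :
  P0 M r th (mom pt pr pth pph) = m <->
  pup M r th (mom pt pr pth pph) ord0 ^+ 2 = W pr pth pph ^+ 2.
Proof.
have key : pup M r th (mom pt pr pth pph) ord0 ^+ 2 - W pr pth pph ^+ 2 =
    (1 + B) * (- gpp M r th (mom pt pr pth pph) - m ^+ 2).
  by rewrite gppE pupE shell_speed_sqr; ring.
have BN0 : 1 + B != 0 by rewrite gt_eqF// addr_gt0.
split=> [Pm|pW].
  apply/eqP; rewrite -subr_eq0 key mulf_eq0 (negbTE BN0)/= -Pm.
  rewrite /P0 sqr_sqrtr ?subrr//.
  (* A positive mass excludes negative arguments, on which the square root is truncated to [0]. *)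
  have : 0 < P0 M r th (mom pt pr pth pph) by rewrite Pm.
  by rewrite /P0 sqrtr_gt0 => /ltW.
move/eqP: key; rewrite pW subrr eq_sym mulf_eq0 (negbTE BN0)/= subr_eq0.
by rewrite /P0 => /eqP->; rewrite sqrtr_sqr gtr0_norm.
Qed.

(** Solution in [p_t] of the linear equation [p^t = W] (future) or [p^t = - W] (past). *)
Definition shell_pt (fut : bool) pr pth pph : R :=
  (B * pr + (if fut then - W pr pth pph else W pr pth pph)) / (1 + B).

Lemma pup_shell_pt fut pr pth pph :
  pup M r th (mom (shell_pt fut pr pth pph) pr pth pph) ord0 =
  if fut then W pr pth pph else - W pr pth pph.
Proof.
have BN0 : 1 + B != 0 by rewrite gt_eqF// addr_gt0.
by rewrite pupE /shell_pt; case: fut; field.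
Qed.

Lemma pt_rootE fut pr pth pph :
  pt_root M m r th fut pr pth pph = shell_pt fut pr pth pph.
Proof.
have BN0 : 1 + B != 0 by rewrite gt_eqF// addr_gt0.
have W0 := shell_speed_gt0 pr pth pph.
rewrite /pt_root; case: xgetP => [pt _ [/mass_shellE/eqP]|/(_ (shell_pt fut pr pth pph))].
  rewrite eqf_sqr => /orP[] /eqP pE; rewrite pE; case: fut => //= sgn.
  - by rewrite /shell_pt -pE pupE; field.
  - by move: sgn; rewrite ltNge ltW.
  - by move: sgn; rewrite oppr_gt0 ltNge ltW.
  - by rewrite /shell_pt -[W _ _ _]opprK -pE pupE; field.
case; split; last by rewrite pup_shell_pt; case: fut; rewrite ?oppr_lt0.
by apply/mass_shellE; rewrite pup_shell_pt; case: fut; rewrite ?sqrrN.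
Qed.

Lemma gpp_shell_pt fut pr pth pph :
  - gpp M r th (mom (shell_pt fut pr pth pph) pr pth pph) = m ^+ 2.
Proof.
have BN0 : 1 + B != 0 by rewrite gt_eqF// addr_gt0.
have := shell_speed_sqr pr pth pph; rewrite gppE /shell_pt => WE.
have -> : ang pth pph = (W pr pth pph ^+ 2 - pr ^+ 2) / (1 + B) - m ^+ 2.
  by rewrite WE; field.
by case: fut; field.
Qed.

Lemma future_timelike_shell_pt fut pr pth pph :
  future_timelike M r th (mom (shell_pt fut pr pth pph) pr pth pph) = fut.
Proof.
rewrite /future_timelike gpp_shell_pt exprn_gt0//= pup_shell_pt.
by case: fut; rewrite ?oppr_gt0 ?shell_speed_gt0// ltNge ltW ?shell_speed_gt0.
Qed.

(** The derivative of [P0] in [p_t] is [- p^t / P0], of absolute value [W / m] on the shell. *)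
Lemma delta_weightE fut pr pth pph :
  delta_weight M r th (shell_pt fut pr pth pph) pr pth pph = m / W pr pth pph.
Proof.
rewrite /delta_weight; set y := shell_pt _ _ _ _.
pose f := fun x : R => (1 + B) * (x * x) - 2 * B * pr * x
  - ((1 - B) * pr ^+ 2 + ang pth pph).
have -> : (fun y => P0 M r th (mom y pr pth pph)) = Num.sqrt \o f.
  by apply/funext => x; rewrite /P0 gppE /= /f; congr Num.sqrt; ring.
have fy : f y = m ^+ 2.
  by rewrite -(gpp_shell_pt fut pr pth pph) gppE /f -/y; ring.
have fy0 : 0 < f y by rewrite fy exprn_gt0.
have dsqrt := is_derive1_sqrt fy0.
have df : is_derive y 1 f ((1 + B) * (y + y) - 2 * B * pr).
  have dM : is_derive y 1 (fun x : R => x * x) (y *: 1 + y *: 1 : R).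
    exact: is_deriveM.
  have dA : is_derive y 1 (fun x : R => (1 + B) * (x * x))
      ((1 + B) *: (y *: 1 + y *: 1 : R)) by exact: is_deriveZ.
  have dB : is_derive y 1 (fun x : R => 2 * B * pr * x) (2 * B * pr *: (1 : R)).
    exact: is_deriveZ.
  have dC := is_derive_cst ((1 - B) * pr ^+ 2 + ang pth pph : R) y 1.
  rewrite (_ : f = (fun x : R => (1 + B) * (x * x)) - (fun x => 2 * B * pr * x)
      - cst ((1 - B) * pr ^+ 2 + ang pth pph)) //.
  apply: (is_derive_eq (is_deriveB (is_deriveB dA dB) dC)).
  by rewrite subr0 /GRing.scale/= !mulr1.
rewrite derive1E (derive_val (is_derive := is_derive1_comp dsqrt df)).
rewrite fy sqrtr_sqr (gtr0_norm m0).
have -> : (2 * m)^-1 * ((1 + B) * (y + y) - 2 * B * pr) =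
    - pup M r th (mom y pr pth pph) ord0 / m.
  by rewrite pupE; field; rewrite gt_eqF.
rewrite pup_shell_pt normrM normrN normfV (gtr0_norm m0) div1r invfM invrK mulrC.
by case: (fut); rewrite ?normrN gtr0_norm ?shell_speed_gt0.
Qed.

Lemma shell_pt_norm pr pth pph : `|shell_pt true pr pth pph| <= W pr pth pph.
Proof.
have BD0 : 0 < 1 + B by rewrite addr_gt0.
rewrite /shell_pt normrM normfV (gtr0_norm BD0) ler_pdivrMr//.
rewrite (le_trans (ler_normD _ _))// normrN normrM (gtr0_norm B0).
rewrite (gtr0_norm (shell_speed_gt0 _ _ _)).
by rewrite mulrDr mulr1 addrC lerD2l mulrC ler_wpM2r ?shell_speed_ge_r// ltW.
Qed.

(** From [|pr| <= W] follows [W - B * pr >= (1 - B) * W]. The constant is positive precisely because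
    the observer sits outside the horizon, where [B < 1]. *)
Lemma energy_ge pr pth pph :
  (1 - B) / (m * (1 + B)) * W pr pth pph <= - shell_pt true pr pth pph / m.
Proof.
have BD0 : 0 < 1 + B by rewrite addr_gt0.
rewrite /shell_pt; have -> : - ((B * pr - W pr pth pph) / (1 + B)) / m =
    (W pr pth pph - B * pr) / (m * (1 + B)) by field; rewrite !gt_eqF.
have mB0 : 0 <= (m * (1 + B))^-1 by rewrite invr_ge0 ltW// mulr_gt0.
rewrite mulrAC ler_wpM2r//.
rewrite mulrBl mul1r lerD2l lerN2 ler_wpM2l ?(ltW B0)//.
by rewrite (le_trans (ler_norm pr))// shell_speed_ge_r.
Qed.

Let N0 : 0 < 1 - B. Proof. by rewrite subr_gt0. Qed.

Lemma pairing_frame_le a pr pth pph :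
  `|pairing (mom (shell_pt true pr pth pph) pr pth pph) (frame M r th a)| <=
  (Num.sqrt (1 - B))^-1 * W pr pth pph.
Proof.
have sN0 : 0 < Num.sqrt (1 - B) by rewrite sqrtr_gt0.
have sN1 : 1 <= (Num.sqrt (1 - B))^-1.
  by rewrite invf_ge1// -[leRHS]sqrtr1 ler_wsqrtr// gerBl ltW.
have W0 := shell_speed_ge0 pr pth pph.
have hpt := shell_pt_norm pr pth pph.
have hr := shell_speed_ge_r pr pth pph.
have hth := shell_speed_ge_th pr pth pph.
have hph := shell_speed_ge_ph pr pth pph.
have scale x : `|x| <= W pr pth pph -> `|x| <= (Num.sqrt (1 - B))^-1 * W pr pth pph.
  by move=> xW; rewrite (le_trans xW)// ler_peMl.
rewrite /pairing !big_ord_recl big_ord0 /mom /frame /=.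
case: a => -[|[|[|[|//]]]] ? /=; rewrite -/B ?mulr0 ?addr0 ?add0r.
- rewrite div1r mulrC normrM normfV (gtr0_norm sN0).
  by rewrite ler_wpM2l ?invr_ge0 ?sqrtr_ge0.
(* Up to the factor [(1 - B)^(-1/2)], the radial component is a convex combination of [p_t] and
   [p_r], each bounded by [W]. *)
- rewrite (_ : _ + _ = (Num.sqrt (1 - B))^-1 *
      (B * shell_pt true pr pth pph + (1 - B) * pr)); last by ring.
  rewrite normrM normfV (gtr0_norm sN0).
  rewrite ler_wpM2l ?invr_ge0 ?sqrtr_ge0// (le_trans (ler_normD _ _))//.
  rewrite (normrM B) (normrM (1 - B)) (gtr0_norm B0) (gtr0_norm N0).
  rewrite (le_trans (lerD (ler_wpM2l (ltW B0) hpt) (ler_wpM2l (ltW N0) hr)))//.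
  by rewrite -mulrDl addrC subrK mul1r.
- by rewrite mulrA mulr1 scale.
- by rewrite mulrA mulr1 scale.
Qed.

End mass_shell.

(** * Measurability of guarded compositions *)

Section generic_composition.
Context {R : realType} d (T : measurableType d).

Lemma measurable_set_bool (b : T -> bool) :
  measurable_fun setT b -> measurable [set t | b t].
Proof.
move=> mb; rewrite [X in measurable X](_ : _ = setT `&` b @^-1` [set true]).
  exact: mb.
by rewrite setTI.
Qed.

(** The initial data are measurable on their region only, so the guard [C] has to force the argument
    into that region. *)
Lemma measurable_fun_if_comp d' (U : measurableType d') (C : T -> bool)
    (S : set U) (F : U -> R) (g : T -> U) (h : T -> R) :
  measurable_fun setT C -> measurable S -> measurable_fun S F ->
  measurable_fun setT g -> measurable_fun setT h ->
  (forall t, C t -> S (g t)) ->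
  measurable_fun setT (fun t => if C t then F (g t) else h t).
Proof.
move=> mC mS mF mg mh CS; apply: measurable_fun_if => //; last first.
  exact: measurable_funTS.
apply: (measurable_comp mS) => //; last exact: measurable_funTS.
by move=> _ [t [_ Ct] <-]; exact: CS.
Qed.

End generic_composition.

(** * Reduction of angles modulo a period *)

Section periodic_reduction.
Context {R : realType}.

Lemma periodic_floor (f : R -> R) p : 0 < p -> (forall x, f (x + p) = f x) ->
  forall x, f (x - p * (Num.floor (x / p))%:~R) = f x.
Proof.
move=> p0 fp x; have fN n y : f (y + p *+ n) = f y.
  exact: (periodicn (f := f) (T := p)).
(* [fN] covers natural multiples; a nonnegative floor is handled by shifting the left-hand side
   back. *)
case: (Num.floor (x / p)) => n.
  by rewrite -[LHS](fN n) -(mulr_natr p n) -pmulrn subrK.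
by rewrite NegzE mulrNz mulrN opprK mulr_natr fN.
Qed.

Lemma periodic_rep_itv (x p : R) : 0 < p ->
  0 <= x - p * (Num.floor (x / p))%:~R <= p.
Proof.
move=> p0; have := floor_le (x / p); have := floorD1_gt (x / p).
rewrite ltr_pdivrMr// ler_pdivlMr// rmorphD/= => h1 h2.
by apply/andP; split; nra.
Qed.

End periodic_reduction.

(** * Sign and measurability of the radial integrals *)

Section radial.
Context {R : realType}.

(** Outside the horizon [Ueff] is nonnegative, hence [s <= eps] and the numerator is nonpositive. At
    [x = 2] the inverse of [0] makes the value [0]. *)
Lemma fpm_absorbed_le0 (eps lam x : R) : 1 < eps -> 2 <= x ->
  fpm (-1) eps lam x <= 0.
Proof.
move=> e1 x2; have x0 : 0 < x by rewrite (lt_le_trans _ x2).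
have le1 : 2 / x <= 1 by rewrite ler_pdivrMr// mul1r.
have xV : 0 <= 2 / x by rewrite divr_ge0// ltW.
have U0 : 0 <= Ueff lam x.
  rewrite mulr_ge0 ?subr_ge0// addr_ge0// divr_ge0 ?sqr_ge0//.
have s_eps : Defs.sfun eps lam x <= eps.
  rewrite -[leRHS]ger0_norm; last by rewrite ltW// (lt_trans _ e1).
  by rewrite -sqrtr_sqr ler_wsqrtr// gerBl.
have s0 : 0 <= Defs.sfun eps lam x by exact: sqrtr_ge0.
rewrite /fpm mulN1r mulr_le0_ge0//.
  by rewrite subr_le0 (le_trans _ s_eps)// ler_piMl.
by rewrite invr_ge0 mulr_ge0// subr_ge0.
Qed.

(** Ensures that [G - tau] stays in the domain [G <= 0] of the absorbed data at all times
    [t >= 0]. *)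
Lemma G_abs_le0 (eps lam xi : R) : 1 < eps -> G_abs eps lam xi <= 0.
Proof.
move=> e1; rewrite /G_abs /Rintegral; apply: fine_le0.
have F0 x : `[2, xi]%classic x -> (0 <= - (fpm (-1) eps lam x)%:E)%E.
  rewrite /= in_itv/= => /andP[x2 _].
  by rewrite lee_fin oppr_ge0 fpm_absorbed_le0.
under eq_integral do rewrite -[_%:E]oppeK.
rewrite integral_ge0N//.
by rewrite oppe_le0; exact: integral_ge0.
Qed.

(* [xi0] is only known to be measurable for energies above the rest mass. *)
Definition xi0_gt1 (eps lam : R) : R := if 1 < eps then xi0 eps lam else 0.

Section measurable_radial.
Context d (T : measurableType d).
Implicit Types e l x : T -> R.

Lemma measurable_Ueff l x : measurable_fun setT l -> measurable_fun setT x ->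
  measurable_fun setT (fun t => Ueff (l t) (x t)).
Proof.
move=> ml mx; apply: measurable_funM.
  by apply: measurable_funB => //; apply: measurable_funM => //; exact: measurable_funV.
apply: measurable_funD => //; apply: measurable_funM; first exact: measurable_funX.
by apply: measurable_funV; exact: measurable_funX.
Qed.

Lemma measurable_sfun e l x : measurable_fun setT e -> measurable_fun setT l ->
  measurable_fun setT x -> measurable_fun setT (fun t => Defs.sfun (e t) (l t) (x t)).
Proof.
move=> me ml mx; apply: measurable_fun_sqrtr; apply: measurable_funB.
  exact: measurable_funX.
exact: measurable_Ueff.
Qed.

Lemma measurable_fpm sg e l x : measurable_fun setT e -> measurable_fun setT l ->
  measurable_fun setT x ->
  measurable_fun setT (fun t => fpm sg (e t) (l t) (x t)).
Proof.
move=> me ml mx; have ms := measurable_sfun me ml mx.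
have mV : measurable_fun setT (fun t => 2 / x t).
  by apply: measurable_funM => //; exact: measurable_funV.
apply: measurable_funM.
  by apply: measurable_funD; exact: measurable_funM.
by apply: measurable_funV; apply: measurable_funM => //; exact: measurable_funB.
Qed.

Lemma measurable_pixi sg e l xi : measurable_fun setT e -> measurable_fun setT l ->
  measurable_fun setT (fun t => pixi sg (e t) (l t) xi).
Proof.
move=> me ml; have ms := measurable_sfun me ml (measurable_cst xi).
by apply: measurable_funM => //; apply: measurable_funD; exact: measurable_funM.
Qed.

Lemma measurable_lam_c e : measurable_fun setT e ->
  measurable_fun setT (fun t => lam_c (e t)).
Proof.
move=> me; have ma : measurable_fun setT (fun t => 9 / 8 * e t ^+ 2 - 1).
  by apply: measurable_funB => //; apply: measurable_funM => //; exact: measurable_funX.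
apply: measurable_fun_sqrtr; apply: measurable_funM => //; apply: measurable_funV.
apply: measurable_funD.
  apply: measurable_funB; last by apply: measurable_funM => //; exact: measurable_funX.
  by apply: measurable_funB => //; exact: measurable_funM.
apply: measurable_funM; first exact: measurable_funM.
by apply: measurable_fun_sqrtr; apply: measurable_funD => //; exact: measurable_funX.
Qed.

End measurable_radial.

Section measurable_orbit.
Context d (T : measurableType d) (e l : T -> R).
Hypotheses (me : measurable_fun setT e) (ml : measurable_fun setT l).

Lemma measurable_xi0_gt1 : measurable_fun setT (fun t => xi0_gt1 (e t) (l t)).
Proof. exact: measurable_xi0. Qed.

Lemma measurable_Rintegral_fpm sg (a : T -> R) xi : measurable_fun setT a ->
  measurable_fun setT
    (fun t => Rintegral (@leb R) `[a t, xi] (fpm sg (e t) (l t))).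
Proof.
move=> ma; apply: (@measurable_Rintegral_itv _ _ _ a (cst xi)
  (fun t => fpm sg (e t) (l t))) => //.
apply: (@measurable_fpm _ _ sg (fun z : T * measurableTypeR R => e z.1)
    (fun z => l z.1) snd);
  by [exact: measurableT_comp|exact: measurable_snd].
Qed.

Lemma measurable_Q3_rad sg (a : T -> R) xi : measurable_fun setT a ->
  measurable_fun setT (fun t => Q3_rad sg (a t) (e t) (l t) xi).
Proof.
move=> ma; apply: measurable_funM; first exact: measurable_funN.
apply: (@measurable_Rintegral_itv _ _ _ a (cst xi)
  (fun t x => 1 / (x ^+ 2 * sg * Defs.sfun (e t) (l t) x))) => //.
have m2 : measurable_fun [set: T * measurableTypeR R] snd by exact: measurable_snd.
apply: measurable_funM => //; apply: measurable_funV; apply: measurable_funM.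
  by apply: measurable_funM => //; exact: measurable_funX.
apply: (@measurable_sfun _ _ (fun z : T * measurableTypeR R => e z.1)
    (fun z => l z.1) snd) => //; exact: measurableT_comp.
Qed.

End measurable_orbit.
End radial.

(** * Measurability of the two regions carrying the initial data *)

Section measurable_regions.
Context {R : realType}.
Let V : Type := (R * R * R * R * R * R)%type.

Let m6 : measurable_fun [set: V] snd. Proof. exact: measurable_snd. Qed.
Let m5 : measurable_fun [set: V] (fun v => v.1.2).
Proof. by apply: (measurableT_comp measurable_snd); exact: measurable_fst. Qed.
Let m4 : measurable_fun [set: V] (fun v => v.1.1.2).
Proof.
apply: (measurableT_comp measurable_snd).
by apply: (measurableT_comp measurable_fst); exact: measurable_fst.
Qed.
Let m1 : measurable_fun [set: V] (fun v => v.1.1.1.1.1).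
Proof.
do 4 apply: (measurableT_comp measurable_fst).
exact: measurable_fst.
Qed.

Lemma measurable_R_abs : measurable [set v : R * R * R * R * R * R |
  R_abs v.1.1.1.1.1 v.1.1.2 v.1.2 v.2].
Proof.
rewrite [X in measurable X](_ : _ = [set v | [&& v.1.1.1.1.1 <= 0,
    1 < v.1.1.2, `|v.1.2| < v.2 & v.2 < lam_c v.1.1.2]]); last first.
  apply/seteqP; split => v /=; first by move=> [-> [-> [-> ->]]].
  by move=> /and4P[].
apply: measurable_set_bool; apply: measurable_and.
  exact: measurable_fun_ler.
apply: measurable_and; first exact: measurable_fun_ltr.
apply: measurable_and.
  by apply: measurable_fun_ltr => //; exact: measurableT_comp.
by apply: measurable_fun_ltr => //; exact: measurable_lam_c.
Qed.

Lemma measurable_R_scat : measurable [set v : R * R * R * R * R * R |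
  R_scat v.1.1.2 v.1.2 v.2].
Proof.
rewrite [X in measurable X](_ : _ = [set v | [&& 1 < v.1.1.2,
    `|v.1.2| < v.2 & lam_c v.1.1.2 < v.2]]); last first.
  apply/seteqP; split => v /=; first by move=> [-> [-> ->]].
  by move=> /and3P[].
apply: measurable_set_bool; apply: measurable_and.
  exact: measurable_fun_ltr.
apply: measurable_and.
  by apply: measurable_fun_ltr => //; exact: measurableT_comp.
by apply: measurable_fun_ltr => //; exact: measurable_lam_c.
Qed.

End measurable_regions.

(** * The solution on the future mass shell: measurability, bound and late-time limit *)

Section asymptotics.
Context {R : realType}.
Variables (M m : R) (Fa Fs : R -> R -> R -> R -> R -> R -> R) (fm : R -> R).
Variables (r th ph : R).
Hypotheses (M0 : 0 < M) (m0 : 0 < m) (Mr : 2 * M < r) (thI : 0 < th < pi).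
Hypothesis mFa : measurable_fun [set v : R * R * R * R * R * R |
  R_abs v.1.1.1.1.1 v.1.1.2 v.1.2 v.2] (unc6 Fa).
Hypothesis mFs : measurable_fun [set v : R * R * R * R * R * R |
  R_scat v.1.1.2 v.1.2 v.2] (unc6 Fs).
Hypothesis perFa : forall G q2 q3 eps lamz lam, R_abs G eps lamz lam ->
  Fa G (q2 + 2 * pi) q3 eps lamz lam = Fa G q2 q3 eps lamz lam /\
  Fa G q2 (q3 + 2 * pi) eps lamz lam = Fa G q2 q3 eps lamz lam.
Hypothesis perFs : forall G q2 q3 eps lamz lam, R_scat eps lamz lam ->
  Fs G (q2 + 2 * pi) q3 eps lamz lam = Fs G q2 q3 eps lamz lam /\
  Fs G q2 (q3 + 2 * pi) eps lamz lam = Fs G q2 q3 eps lamz lam.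
Variables C b : R.
Hypotheses (C0 : 0 < C) (b0 : 0 < b).
Hypothesis bndFa : forall G q2 q3 eps lamz lam, R_abs G eps lamz lam ->
  0 <= Fa G q2 q3 eps lamz lam <= C * expR (- (b * eps)).
Hypothesis bndFs : forall G q2 q3 eps lamz lam, R_scat eps lamz lam ->
  0 <= Fs G q2 q3 eps lamz lam <= C * expR (- (b * eps)).
Hypothesis limFa : forall q2 q3 eps lamz lam,
  0 <= q2 <= 2 * pi -> 0 <= q3 <= 2 * pi ->
  1 < eps -> `|lamz| < lam -> lam < lam_c eps ->
  Fa G q2 q3 eps lamz lam @[G --> -oo] --> fm eps.
Hypothesis limFs : forall eps, 1 < eps ->
  forall eta, 0 < eta -> exists G0 : R, forall G, G <= G0 ->
  forall q2 q3 lamz lam, 0 <= q2 <= 2 * pi -> 0 <= q3 <= 2 * pi ->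
  `|lamz| < lam -> lam_c eps < lam ->
  `|Fs G q2 q3 eps lamz lam - fm eps| <= eta.

Let twopi0 : 0 < 2 * pi :> R.
Proof. by rewrite mulr_gt0// pi_gt0. Qed.

Let rep (x : R) := x - 2 * pi * (Num.floor (x / (2 * pi)))%:~R.

Lemma limFa_all (G : R ^nat) q2 q3 eps lamz lam :
  (forall n, R_abs (G n) eps lamz lam) -> G n @[n --> \oo] --> -oo ->
  Fa (G n) q2 q3 eps lamz lam @[n --> \oo] --> fm eps.
Proof.
move=> GR Goo; have [_ [e1 [lz lc]]] := GR 0%N.
have FaE n : Fa (G n) q2 q3 eps lamz lam = Fa (G n) (rep q2) (rep q3) eps lamz lam.
  rewrite -[LHS](periodic_floor (f := fun x => Fa (G n) x q3 eps lamz lam) twopi0);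
    last by move=> x; exact: (perFa _ _ (GR n)).1.
  rewrite -[LHS](periodic_floor
    (f := fun x => Fa (G n) _ x eps lamz lam) twopi0)//.
  by move=> x; exact: (perFa _ _ (GR n)).2.
under eq_fun do rewrite FaE.
have lim := limFa (periodic_rep_itv q2 twopi0) (periodic_rep_itv q3 twopi0) e1 lz lc.
exact: (cvg_comp G (fun x => Fa x (rep q2) (rep q3) eps lamz lam) Goo lim).
Qed.

Lemma limFs_all (G : R ^nat) q2 q3 eps lamz lam :
  R_scat eps lamz lam -> G n @[n --> \oo] --> -oo ->
  Fs (G n) q2 q3 eps lamz lam @[n --> \oo] --> fm eps.
Proof.
move=> GR Goo; have [e1 [lz lc]] := GR.
have FsE n : Fs (G n) q2 q3 eps lamz lam = Fs (G n) (rep q2) (rep q3) eps lamz lam.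
  rewrite -[LHS](periodic_floor (f := fun x => Fs (G n) x q3 eps lamz lam) twopi0);
    last by move=> x; exact: (perFs _ _ _ GR).1.
  rewrite -[LHS](periodic_floor
    (f := fun x => Fs (G n) _ x eps lamz lam) twopi0)//.
  by move=> x; exact: (perFs _ _ _ GR).2.
under eq_fun do rewrite FsE.
apply/cvgrPdist_le => eta eta0; have [G0 FG0] := limFs e1 eta0.
move/cvgrNyPle/(_ G0): Goo; apply: filterS => n GnG0.
by rewrite distrC; apply: FG0 => //; exact: periodic_rep_itv.
Qed.

Local Notation W q := (shell_speed M m r th q.1.1 q.1.2 q.2).
Local Notation pt q := (shell_pt M m r th true q.1.1 q.1.2 q.2).
Let xi := r / M.
Let eps (q : R * R * R) : R := - pt q / m.
Let lamz (q : R * R * R) := q.2 / (M * m).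
Let pith (q : R * R * R) := q.1.2 / (M * m).
Let lam (q : R * R * R) : R :=
  Num.sqrt (q.1.2 ^+ 2 + q.2 ^+ 2 / sin th ^+ 2) / (M * m).

Let q3m : measurable_fun [set: R * R * R] snd.
Proof. exact: measurable_snd. Qed.
Let q2m : measurable_fun [set: R * R * R] (fun q => q.1.2).
Proof. by apply: (measurableT_comp measurable_snd); exact: measurable_fst. Qed.
Let q1m : measurable_fun [set: R * R * R] (fun q => q.1.1).
Proof. by apply: (measurableT_comp measurable_fst); exact: measurable_fst. Qed.

Lemma measurable_shell_speed : measurable_fun [set: R * R * R] (fun q => W q).
Proof.
apply: measurable_fun_sqrtr; apply: measurable_funD; first exact: measurable_funX.
apply: measurable_funM => //; apply: measurable_funD => //.
by apply: measurable_funD; apply: measurable_funM => //; exact: measurable_funX.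
Qed.

Lemma measurable_shell_pt : measurable_fun [set: R * R * R] (fun q => pt q).
Proof.
have mW := measurable_shell_speed.
apply: measurable_funM => //; apply: measurable_funD; first exact: measurable_funM.
exact: measurable_funN.
Qed.

Let meps : measurable_fun setT eps.
Proof.
apply: measurable_funM => //; apply: measurable_funN; exact: measurable_shell_pt.
Qed.

Let mlamz : measurable_fun setT lamz.
Proof. exact: measurable_funM. Qed.

Let mpith : measurable_fun setT pith.
Proof. exact: measurable_funM. Qed.

Let mlam : measurable_fun setT lam.
Proof.
apply: measurable_funM => //; apply: measurable_fun_sqrtr; apply: measurable_funD.
  exact: measurable_funX.
by apply: measurable_funM => //; exact: measurable_funX.
Qed.

(** The cases of [accr_case] on the future shell, with [xi0_gt1] in place of [xi0] so that the
    guards are measurable on all of momentum space. *)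
Let inner q := (1 < eps q) && (`|lamz q| < lam q).
Let absorbed q := inner q &&
  ((lam q < lam_c (eps q)) && (q.1.1 / m == pixi (-1) (eps q) (lam q) xi)).
Let scattered sg q := inner q && ((lam_c (eps q) < lam q) &&
  (xi0_gt1 (eps q) (lam q) <= xi) && (q.1.1 / m == pixi sg (eps q) (lam q) xi)).

Let minner : measurable_fun setT inner.
Proof.
apply: measurable_and; first exact: measurable_fun_ltr.
by apply: measurable_fun_ltr => //; exact: measurableT_comp.
Qed.

Let mabsorbed : measurable_fun setT absorbed.
Proof.
apply: measurable_and => //; apply: measurable_and.
  by apply: measurable_fun_ltr => //; exact: measurable_lam_c.
apply: measurable_fun_eqr; first exact: measurable_funM.
exact: measurable_pixi.
Qed.

Let mscattered sg : measurable_fun setT (scattered sg).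
Proof.
apply: measurable_and => //; apply: measurable_and.
  apply: measurable_and.
    by apply: measurable_fun_ltr => //; exact: measurable_lam_c.
  by apply: measurable_fun_ler => //; exact: measurable_xi0_gt1.
apply: measurable_fun_eqr; first exact: measurable_funM.
exact: measurable_pixi.
Qed.

Lemma accr_case_shell_pt q :
  accr_case M m r th (pt q) q.1.1 q.1.2 q.2 =
  if absorbed q then 1%N else if scattered 1 q then 2%N
  else if scattered (-1) q then 3%N else 0%N.
Proof.
rewrite /accr_case future_timelike_shell_pt//= -/(eps q) -/(lamz q) -/(lam q).
rewrite /absorbed /scattered /inner /xi0_gt1.
by case: (1 < eps q); case: (`|lamz q| < lam q).
Qed.

(** Everywhere measurable substitutes for the angular quantities, equal to them where [inner]
    holds. *)
Let psi q := psi_endE (lam q) (lamz q) th (pith q).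
Let Q2s q := ph - lamz q * Rintegral (@leb R) `[0, psi q]
  (fun x => (if cos x == 0 then 0 else (lam q)^-1) /
            (1 - (kincl (lam q) (lamz q) * sin x) ^+ 2)).
Let Q3s q : R := lam q * Rintegral (@leb R) `[0, psi q]
  (fun x => if cos x == 0 then 0 else (lam q)^-1).

Lemma Q2_Q3_shell q : inner q ->
  Q2 ph (lam q) (lamz q) th (pith q) = Q2s q /\
  Q3_ang (lam q) (lamz q) th (pith q) = Q3s q.
Proof.
move=> /andP[_ lz]; have psiE : psi_end (lam q) (lamz q) th (pith q) = psi q.
  apply: psi_end_eq => //.
  have sth : sin th != 0 by rewrite gt_eqF// sin_gt0_pi.
  rewrite /lam expr_div_n sqr_sqrtr; last first.
    by apply: addr_ge0; rewrite ?sqr_ge0// divr_ge0 ?sqr_ge0.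
  by rewrite /pith /lamz; field; rewrite sth !gt_eqF.
by rewrite Q2E// Q3_angE// psiE.
Qed.

Let Gabs (t : R) (q : R * R * R) : R * R * R * R * R * R :=
  (G_abs (eps q) (lam q) xi - t / M, Q2s q,
  Q3_rad (-1) 2 (eps q) (lam q) xi + Q3s q, eps q, lamz q, lam q).
Let Gscat (sg t : R) (q : R * R * R) : R * R * R * R * R * R :=
  (Rintegral (@leb R) `[xi0_gt1 (eps q) (lam q), xi] (fpm sg (eps q) (lam q))
     - t / M, Q2s q,
   Q3_rad sg (xi0_gt1 (eps q) (lam q)) (eps q) (lam q) xi + Q3s q,
   eps q, lamz q, lam q).

Let sol t q := if absorbed q then unc6 Fa (Gabs t q)
  else if scattered 1 q then unc6 Fs (Gscat 1 t q)
  else if scattered (-1) q then unc6 Fs (Gscat (-1) t q) else 0.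

Lemma fsol_shell_pt t q :
  fsol M m Fa Fs t r th ph (pt q) q.1.1 q.1.2 q.2 = sol t q.
Proof.
rewrite /fsol accr_case_shell_pt -/(eps q) -/(lamz q) -/(lam q) -/(pith q).
rewrite /sol; case: ifPn => [/andP[/Q2_Q3_shell[-> ->]]//|_].
have xi0E : inner q -> xi0 (eps q) (lam q) = xi0_gt1 (eps q) (lam q).
  by move=> /andP[e1 _]; rewrite /xi0_gt1 e1.
case: ifPn => [/andP[qi _]|_].
  by have [-> ->] := Q2_Q3_shell qi; rewrite /G_scat xi0E.
case: ifPn => [/andP[qi _]|_ //].
by have [-> ->] := Q2_Q3_shell qi; rewrite /G_scat xi0E.
Qed.

Lemma fsol_past t q :
  fsol M m Fa Fs t r th ph (shell_pt M m r th false q.1.1 q.1.2 q.2)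
    q.1.1 q.1.2 q.2 = 0.
Proof. by rewrite /fsol /accr_case future_timelike_shell_pt. Qed.

Lemma f_stat_shell_pt q : f_stat M m fm r th (pt q) q.1.1 q.1.2 q.2 =
  if [|| absorbed q, scattered 1 q | scattered (-1) q] then fm (eps q) else 0.
Proof.
rewrite /f_stat accr_case_shell_pt -/(eps q); case: (absorbed q) => //=.
by case: (scattered 1 q) => //=; case: (scattered (-1) q).
Qed.

Lemma f_stat_past q : f_stat M m fm r th
  (shell_pt M m r th false q.1.1 q.1.2 q.2) q.1.1 q.1.2 q.2 = 0.
Proof. by rewrite /f_stat /accr_case future_timelike_shell_pt. Qed.

Lemma Gabs_R (t : R) q : 0 <= t -> absorbed q ->
  R_abs (Gabs t q).1.1.1.1.1 (eps q) (lamz q) (lam q).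
Proof.
move=> t0 /andP[/andP[e1 lz] /andP[lc _]]; split; last by split.
by rewrite /= subr_le0 (le_trans (G_abs_le0 _ _ e1))// divr_ge0// ltW.
Qed.

Lemma scattered_R sg q : scattered sg q -> R_scat (eps q) (lamz q) (lam q).
Proof. by move=> /andP[/andP[e1 lz] /andP[/andP[lc _] _]]. Qed.

Let mxi0 : measurable_fun setT (fun q => xi0_gt1 (eps q) (lam q)).
Proof. exact: measurable_xi0_gt1. Qed.

Let mQ2s : measurable_fun setT Q2s.
Proof. exact: measurable_curve_int2. Qed.

Let mQ3s : measurable_fun setT Q3s.
Proof. exact: measurable_curve_int3. Qed.

Let measurable_tuple6 (f1 f2 f3 : R * R * R -> R) : measurable_fun setT f1 ->
  measurable_fun setT f2 -> measurable_fun setT f3 ->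
  measurable_fun setT (fun q => (f1 q, f2 q, f3 q, eps q, lamz q, lam q)).
Proof.
move=> mf1 mf2 mf3; apply: measurable_fun_pair => //.
apply: measurable_fun_pair => //; apply: measurable_fun_pair => //.
by apply: measurable_fun_pair => //; exact: measurable_fun_pair.
Qed.

Lemma measurable_sol t : 0 <= t -> measurable_fun setT (sol t).
Proof.
move=> t0.
have mGscat sg : measurable_fun setT (Gscat sg t).
  apply: measurable_tuple6 => //.
    by apply: measurable_funB => //; exact: measurable_Rintegral_fpm.
  by apply: measurable_funD => //; exact: measurable_Q3_rad.
apply: (measurable_fun_if_comp _ measurable_R_abs mFa) => //.
- apply: measurable_tuple6 => //.
    apply: measurable_funB => //.
    exact: (measurable_Rintegral_fpm meps mlam (-1) xi (a := fun=> 2)).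
  apply: measurable_funD => //.
  exact: (measurable_Q3_rad meps mlam (-1) xi (a := fun=> 2)).
- apply: (measurable_fun_if_comp _ measurable_R_scat mFs) => //; last first.
    by move=> q /scattered_R.
  apply: (measurable_fun_if_comp _ measurable_R_scat mFs) => //.
  by move=> q /scattered_R.
- by move=> q /(Gabs_R t0).
Qed.

Lemma sol_bound t q : 0 <= t -> 0 <= sol t q <= C * expR (- (b * eps q)).
Proof.
move=> t0; rewrite /sol; case: ifPn => [/(Gabs_R t0)/bndFa|_]; first exact.
case: ifPn => [/scattered_R/bndFs|_]; first exact.
case: ifPn => [/scattered_R/bndFs|_]; first exact.
by rewrite lexx/= mulr_ge0 ?expR_ge0// ltW.
Qed.

Let cvg_shift (u : R ^nat) G : u n @[n --> \oo] --> +oo ->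
  (G - u n / M) @[n --> \oo] --> -oo.
Proof.
move=> /cvgryPge uoo; apply/cvgrNyPle => A.
apply: filterS (uoo ((G - A) * M)) => n; rewrite -ler_pdivlMr// => h.
by rewrite lerBlDr -lerBlDl.
Qed.

(** At fixed momentum the orbit type is independent of time. In each of the three types the first
    argument drifts to [-oo], so absorbed, outgoing and incoming particles share the limit [fm]. *)
Lemma sol_cvg (u : R ^nat) q : (forall n, 0 <= u n) ->
  u n @[n --> \oo] --> +oo ->
  sol (u n) q @[n --> \oo] --> f_stat M m fm r th (pt q) q.1.1 q.1.2 q.2.
Proof.
move=> u0 uoo; rewrite f_stat_shell_pt /sol.
case: (boolP (absorbed q)) => [qa|_] /=.
  apply: (limFa_all (G := fun n => (Gabs (u n) q).1.1.1.1.1)) => [n|].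
    exact: Gabs_R (u0 n) qa.
  exact: cvg_shift.
case: (boolP (scattered 1 q)) => [/scattered_R qR|_] /=.
  apply: (limFs_all (G := fun n => (Gscat 1 (u n) q).1.1.1.1.1)) => //.
  exact: cvg_shift.
case: (boolP (scattered (-1) q)) => [/scattered_R qR|_] /=.
  apply: (limFs_all (G := fun n => (Gscat (-1) (u n) q).1.1.1.1.1)) => //.
  exact: cvg_shift.
exact: cvg_cst.
Qed.

(** * Dominated convergence for a weight [P] of at most quadratic growth *)

Section observable.
Variables (P : R -> R -> R -> R -> R) (K : R).
Hypothesis mP : measurable_fun [set: R * R * R]
  (fun q => P (pt q) q.1.1 q.1.2 q.2).
Hypothesis PK : forall q, `|P (pt q) q.1.1 q.1.2 q.2| <= K * W q ^+ 2.

Let D := Num.sqrt (- \det (ginv M r th)).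
Let integrand f (q : R * R * R) :=
  P (pt q) q.1.1 q.1.2 q.2 * f q * (m / W q) * D.

Lemma shell_integral_future (h : R -> R -> R -> R -> R) :
  (forall q : R * R * R,
    h (shell_pt M m r th false q.1.1 q.1.2 q.2) q.1.1 q.1.2 q.2 = 0) ->
  shell_integral M m r th (fun pt pr pth pph => P pt pr pth pph * h pt pr pth pph) =
  (\int[@leb2 R \x @lebesgue_measure R]_q
    (integrand (fun q => h (pt q) q.1.1 q.1.2 q.2) q)%:E)%E.
Proof.
(* The measure [mu3] unfolds to the product with [leb2], so only the integrands need comparing; the
   past root drops out by [h0]. *)
move=> h0; apply: eq_integral => q _; congr EFin.
by rewrite !pt_rootE// !delta_weightE// h0 mulr0 mul0r addr0.
Qed.

(** By [energy_ge], [b * eps >= a * W]. Half of the rate [a] absorbs the factor [W ^+ 2]; the other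
    half, divided by [1 + 2 * r], becomes the rate [k] in the l^1 norm. *)
Let a := b * ((1 - 2 * M / r) / (m * (1 + 2 * M / r))).
Let k := a / 2 / (1 + 2 * r).

Let r0 : 0 < r. Proof. by rewrite (lt_trans _ Mr)// mulr_gt0. Qed.

Let a0 : 0 < a.
Proof.
have h1 : 0 < 1 - 2 * M / r by rewrite subr_gt0 ltr_pdivrMr// mul1r.
have h2 : 0 < 1 + 2 * M / r by rewrite addr_gt0// divr_gt0// mulr_gt0.
by rewrite mulr_gt0// divr_gt0// mulr_gt0.
Qed.

Let rr0 : 0 < 1 + 2 * r. Proof. by rewrite addr_gt0// mulr_gt0. Qed.

Let k0 : 0 < k. Proof. by rewrite !divr_gt0. Qed.

Let dom (q : R * R * R) :=
  K * C * D * (4 / a) ^+ 2 * expR (- (k * (`|q.1.1| + `|q.1.2| + `|q.2|))).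

(** With [y = a * w / 4], this is the square of [y <= 1 + y <= expR y]. *)
Let sqr_exp (w : R) : 0 <= w -> w ^+ 2 <= (4 / a) ^+ 2 * expR (a / 2 * w).
Proof.
move=> w0; have aw0 : 0 <= a / 4 * w by rewrite mulr_ge0// divr_ge0// ltW.
have -> : w = 4 / a * (a / 4 * w) by field; rewrite gt_eqF.
rewrite exprMn ler_wpM2l ?sqr_ge0//.
have -> : a / 2 * (4 / a * (a / 4 * w)) = 2 * (a / 4 * w).
  by field; rewrite gt_eqF.
rewrite expRM_natl; rewrite lerXn2r// ?nnegrE ?expR_ge0//.
by rewrite (le_trans _ (expR_ge1Dx _))// lerDr.
Qed.

Lemma integrand_dom t q : 0 <= t -> `|integrand (sol t) q| <= dom q.
Proof.
move=> t0; have /andP[s0 sC] := sol_bound q t0.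
have W0 := shell_speed_gt0 th M0 m0 Mr q.1.1 q.1.2 q.2.
have mW : m / W q <= 1 by rewrite ler_pdivrMr// mul1r shell_speed_ge_mass.
have D0 : 0 <= D by exact: sqrtr_ge0.
have mW0 : 0 <= m / W q by rewrite divr_ge0// ltW.
rewrite /integrand (normrM _ D) (normrM _ (m / W q)) (normrM _ (sol t q)).
rewrite (ger0_norm s0) (ger0_norm mW0) (ger0_norm D0).
have KW : 0 <= K * W q ^+ 2 by exact: le_trans (PK q).
(* The sign of [K] is read off from the bound [PK], as [W] is positive. *)
have K0 : 0 <= K by rewrite -(pmulr_lge0 _ (_ : 0 < W q ^+ 2)) ?exprn_gt0.
have eE : expR (- (b * eps q)) <= expR (- (a * W q)).
  by rewrite ler_expR lerN2 /a -mulrA ler_wpM2l ?(ltW b0)// energy_ge.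
have eW : W q ^+ 2 * expR (- (a * W q)) <=
    (4 / a) ^+ 2 * expR (- (k * (`|q.1.1| + `|q.1.2| + `|q.2|))).
  have h : expR (- (a * W q)) = expR (- (a / 2 * W q)) * expR (- (a / 2 * W q)).
    by rewrite -expRD; congr expR; field.
  apply: (@le_trans _ _ ((4 / a) ^+ 2 * expR (- (a / 2 * W q)))).
    rewrite h mulrA ler_wpM2r ?expR_ge0//.
    rewrite expRN ler_pdivrMr ?expR_gt0//.
    by apply: sqr_exp; rewrite ltW.
  rewrite ler_wpM2l ?sqr_ge0// ler_expR lerN2.
  rewrite /k -mulrA ler_wpM2l ?divr_ge0 ?(ltW a0)// ler_pdivrMl//.
  exact: shell_speed_ge_norm1.
rewrite /dom; apply: (@le_trans _ _ (K * W q ^+ 2 * (C * expR (- (a * W q))) * 1 * D)).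
  apply: ler_wpM2r => //; apply: ler_pM => //; first exact: mulr_ge0.
  apply: ler_pM => //; apply: (le_trans sC).
  by rewrite ler_wpM2l// ltW.
have KCD : 0 <= K * C * D by rewrite !mulr_ge0// ltW.
have := ler_wpM2l KCD eW; rewrite [leRHS]mulrA; apply: le_trans.
by rewrite le_eqVlt; apply/orP; left; apply/eqP; ring.
Qed.

Lemma shell_integral_cvg :
  shell_integral M m r th (fun pt pr pth pph =>
    P pt pr pth pph * fsol M m Fa Fs t r th ph pt pr pth pph) @[t --> +oo]
  --> shell_integral M m r th (fun pt pr pth pph =>
    P pt pr pth pph * f_stat M m fm r th pt pr pth pph).
Proof.
(* Dominated convergence is sequential: the limit is tested along sequences of times, shifted by [N]
   so that all times are nonnegative, as the domain of the absorbed data demands. *)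
apply/cvge_pinftyP => u uoo.
have [N _ uN] : \forall n \near \oo, 0 <= u n by move/cvgryPge: uoo; exact.
rewrite -(cvg_shiftn N).
have {}uoo : u (n + N)%N @[n --> \oo] --> +oo by rewrite (cvg_shiftn N u).
have {}uN n : 0 <= u (n + N)%N by apply: uN; exact: leq_addl.
rewrite (shell_integral_future f_stat_past).
under eq_fun do rewrite (shell_integral_future (fsol_past _)).
pose fn n q := (integrand (sol (u (n + N)%N)) q)%:E.
pose f q := (integrand (fun q => f_stat M m fm r th (pt q) q.1.1 q.1.2 q.2) q)%:E.
have -> : (fun n => \int[@leb2 R \x @lebesgue_measure R]_q (integrand (fun q =>
    fsol M m Fa Fs (u (n + N)%N) r th ph (pt q) q.1.1 q.1.2 q.2) q)%:E)%E =
    (fun n => \int[@leb2 R \x @lebesgue_measure R]_q fn n q)%E.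
  by apply/funext => n; apply: eq_integral => q _; rewrite /fn /integrand fsol_shell_pt.
have mfn n : measurable_fun setT (fn n).
  apply/measurable_EFinP; apply: measurable_funM => //; apply: measurable_funM.
    by apply: measurable_funM => //; exact: measurable_sol.
  apply: measurable_funM => //; apply: measurable_funV.
  exact: measurable_shell_speed.
have fnf q : fn ^~ q @ \oo --> f q.
  apply: cvg_EFin; first exact: nearW.
  rewrite /=; apply: cvgMr_tmp; apply: cvgMr_tmp; apply: cvgMl_tmp.
  exact: sol_cvg.
(* Measurability of the stationary integrand, and with it that of [fm] along the shell, is inherited
   from the pointwise limit. *)
have mf : measurable_fun setT f.
  by apply: (emeasurable_fun_cvg fn) => // q _; exact: fnf.
have idom : (@leb2 R \x @lebesgue_measure R)%E.-integrable setT (EFin \o dom).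
  apply: (integrableZl (mu := (@leb2 R \x @lebesgue_measure R)%E) measurableT
    (K * C * D * (4 / a) ^+ 2) (integrable_expR_norm3 k0)).
have [||_ _] := @dominated_convergence _ _ _ (@leb2 R \x @lebesgue_measure R)%E setT
  measurableT fn f (EFin \o dom) mfn mf _ idom.
- by apply: aeW => q _; exact: fnf.
- by apply: aeW => q n _; rewrite /= lee_fin; exact: integrand_dom.
exact.
Qed.

End observable.
End asymptotics.

(** * Frame components and conclusion for the two observables *)

Lemma measurable_pairing_frame (R : realType) (M m r th : R) (a : 'I_4) :
  measurable_fun [set: R * R * R] (fun q =>
    pairing (mom (shell_pt M m r th true q.1.1 q.1.2 q.2) q.1.1 q.1.2 q.2)
      (frame M r th a)).
Proof.
rewrite [X in measurable_fun _ X](_ : _ = fun q : R * R * R =>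
  shell_pt M m r th true q.1.1 q.1.2 q.2 * frame M r th a 0
  + (q.1.1 * frame M r th a 1 + (q.1.2 * frame M r th a 2
  + q.2 * frame M r th a 3))); last first.
  apply/funext => q; rewrite /pairing !big_ord_recl big_ord0 addr0 /mom /=.
  by congr (_ * _ + (_ * _ + (_ * _ + _ * _))); congr (frame _ _ _ _); exact: val_inj.
have m1 : measurable_fun [set: R * R * R] (fun q => q.1).
  exact: measurable_fst.
apply: measurable_funD; first by apply: measurable_funM => //; exact: measurable_shell_pt.
apply: measurable_funD.
  by apply: measurable_funM => //; exact: measurableT_comp measurable_fst m1.
apply: measurable_funD.
  by apply: measurable_funM => //; exact: measurableT_comp measurable_snd m1.
by apply: measurable_funM => //; exact: measurable_snd.
Qed.

Theorem theorem2 (R : realType) (M m : R)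
    (Fa Fs : R -> R -> R -> R -> R -> R -> R) (fm : R -> R)
    (rs ths phs : R) :
  0 < M -> 0 < m ->
  (* (i) *)
  measurable_fun [set v : R * R * R * R * R * R |
                   R_abs v.1.1.1.1.1 v.1.1.2 v.1.2 v.2] (unc6 Fa) ->
  measurable_fun [set v : R * R * R * R * R * R |
                   R_scat v.1.1.2 v.1.2 v.2] (unc6 Fs) ->
  (forall G q2 q3 eps lamz lam, R_abs G eps lamz lam ->
     Fa G (q2 + 2 * pi) q3 eps lamz lam = Fa G q2 q3 eps lamz lam /\
     Fa G q2 (q3 + 2 * pi) eps lamz lam = Fa G q2 q3 eps lamz lam) ->
  (forall G q2 q3 eps lamz lam, R_scat eps lamz lam ->
     Fs G (q2 + 2 * pi) q3 eps lamz lam = Fs G q2 q3 eps lamz lam /\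
     Fs G q2 (q3 + 2 * pi) eps lamz lam = Fs G q2 q3 eps lamz lam) ->
  (exists C b : R, 0 < C /\ 0 < b /\
     (forall G q2 q3 eps lamz lam, R_abs G eps lamz lam ->
        0 <= Fa G q2 q3 eps lamz lam <= C * expR (- (b * eps))) /\
     (forall G q2 q3 eps lamz lam, R_scat eps lamz lam ->
        0 <= Fs G q2 q3 eps lamz lam <= C * expR (- (b * eps)))) ->
  (* (ii) *)
  (forall q2 q3 eps lamz lam, 0 <= q2 <= 2 * pi -> 0 <= q3 <= 2 * pi ->
     1 < eps -> `|lamz| < lam -> lam < lam_c eps ->
     Fa G q2 q3 eps lamz lam @[G --> -oo] --> fm eps) ->
  (* (iii) *)
  (exists fp : R -> R, forall eps, 1 < eps ->
     (forall eta, 0 < eta -> exists G0 : R, forall G, G0 <= G ->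
        forall q2 q3 lamz lam, 0 <= q2 <= 2 * pi -> 0 <= q3 <= 2 * pi ->
        `|lamz| < lam -> lam_c eps < lam ->
        `|Fs G q2 q3 eps lamz lam - fp eps| <= eta) /\
     (forall eta, 0 < eta -> exists G0 : R, forall G, G <= G0 ->
        forall q2 q3 lamz lam, 0 <= q2 <= 2 * pi -> 0 <= q3 <= 2 * pi ->
        `|lamz| < lam -> lam_c eps < lam ->
        `|Fs G q2 q3 eps lamz lam - fm eps| <= eta)) ->
  (* static observer gamma(t) = (t, rs, ths, phs) *)
  2 * M < rs -> 0 < ths < pi ->
  forall a b : 'I_4,
    Jcomp M m rs ths (fsol M m Fa Fs t rs ths phs) a @[t --> +oo]
      --> Jcomp M m rs ths (f_stat M m fm rs ths) a /\
    Tcomp M m rs ths (fsol M m Fa Fs t rs ths phs) a b @[t --> +oo]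
      --> Tcomp M m rs ths (f_stat M m fm rs ths) a b.
Proof.
move=> M0 m0 mFa mFs perFa perFs [C [c [C0 [c0 [bndFa bndFs]]]]] limFa [fp limFs].
move=> Mr thI a b.
have limFs_past eps : 1 < eps -> forall eta, 0 < eta -> exists G0 : R,
    forall G, G <= G0 -> forall q2 q3 lamz lam, 0 <= q2 <= 2 * pi ->
    0 <= q3 <= 2 * pi -> `|lamz| < lam -> lam_c eps < lam ->
    `|Fs G q2 q3 eps lamz lam - fm eps| <= eta.
  by move=> e1; exact: (limFs eps e1).2.
have cvgP := shell_integral_cvg phs M0 m0 Mr thI mFa mFs perFa perFs
  C0 c0 bndFa bndFs limFa limFs_past.
pose k := (Num.sqrt (1 - 2 * M / rs))^-1.
have k0 : 0 <= k by rewrite invr_ge0 sqrtr_ge0.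
have pair_le d pr pth pph : `|pairing (mom (shell_pt M m rs ths true pr pth pph)
    pr pth pph) (frame M rs ths d)| <= k * shell_speed M m rs ths pr pth pph.
  exact: pairing_frame_le.
split.
(* The current has a weight linear in [W]; [m <= W] gives [W <= W ^+ 2 / m], whence the constant
   [k / m]. *)
- apply: (cvgP (fun pt pr pth pph => pairing (mom pt pr pth pph) (frame M rs ths a))
    (k / m)) => [|q]; first exact: measurable_pairing_frame.
  apply: (le_trans (pair_le _ _ _ _)); rewrite -mulrA ler_wpM2l// ler_pdivlMl//.
  have Wm := shell_speed_ge_mass ths M0 m0 Mr q.1.1 q.1.2 q.2.
  by rewrite expr2 ler_wpM2r// shell_speed_ge0.
- apply: (cvgP (fun pt pr pth pph => pairing (mom pt pr pth pph) (frame M rs ths a)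
    * pairing (mom pt pr pth pph) (frame M rs ths b)) (k ^+ 2)) => [|q].
    by apply: measurable_funM; exact: measurable_pairing_frame.
  by rewrite normrM -exprMn expr2 ler_pM.
Qed.
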